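(* Suppose all assumptions of the following result hold: (A1)–(A4); $P^\star\in\Pi_{K^\star}\setminus\Pi_{K^\star-1}$, $K^\star<\infty$; for every $\theta\in\Theta_\infty$, $H(P_\theta|P^\star)<\infty$ and $p_\theta\ell_\theta\in L^1(\mu)$; (i) $\{\ell_\theta:\theta\in\Theta_\infty\}\subset\mathcal L_\tau(P^\star)$; (ii) for every $K\ge1$, every $Q\in\mathcal Q$ and every sufficiently small $\varepsilon>0$ there is a finite $T\subset\Theta_K$ such that every $\theta\in\Theta_K$ has some $t\in T$ with $|Q\ell_\theta-Q\ell_t|\le\varepsilon$. Suppose in addition that each $\Theta_K$ is a subset of a finite-dimensional normed vector space whose norm induces $d$, and: (iii) $u-l\in\mathcal M_\tau(P^\star)$; (iv) for every $K\le K^\star$ and $z\in\mathcal Z$, $\theta\mapsto\ell_\theta(z)$ is differentiable on the interior of $\Theta_K$ with derivative $\dot\ell_\theta(z)$, the coordinates of $\dot\ell_\theta$ belong to $\mathcal M_\tau(P^\star)$, and there is $F\in\mathcal L_\tau(P^\star)$ with $|\ell_{\theta+h}-\ell_\theta-\dot\ell_\theta^{T}h|\le F\cdot o(h)$ (pointwise, with $o(h)$ independent of $z$). Then (a) if, for every $K$, $P^\star\notin\Pi_K$ implies $H(P^\star|\Pi_{K+1})<H(P^\star|\Pi_K)$, $$\limsup_{n\to\infty}n^{-1}\log P^\star\{\widehat K_n^L<K^\star\}\le-\inf_{K<K^\star}H(\Lambda_{0,K}\cap M_1(\mathcal Z)\,|\,P^\star)<0;$$ (b) $$\limsup_{n\to\infty}n^{-1}\log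 P^\star\{\widehat K_n^G<K^\star\}\le-H(\Gamma_{0,K^\star-1}\cap M_1(\mathcal Z)\,|\,P^\star)<0.$$
   Context: Setting: $(\mathcal Z,\mathcal F)$ is a Polish space with its Borel $\sigma$-field and $\mu$ a $\sigma$-finite measure on it. $Z_1,Z_2,\dots$ are i.i.d. $\mathcal Z$-valued random variables with common law $P^\star\ll\mu$, density $p^\star$, $\ell^\star=\log p^\star$; $P^\star$ also denotes the law of the whole sequence. $\{(\Theta_K,d)\}_{K\ge1}$ is an increasing (nested) sequence of metric spaces, $\Theta_\infty=\bigcup_K\Theta_K$; for $\theta\in\Theta_\infty$, $P_\theta$ is a probability measure with density $p_\theta$ w.r.t. $\mu$ and $\ell_\theta=\log p_\theta$. $\Pi_K=\{P_\theta:\theta\in\Theta_K\}$, $\Pi_0=\emptyset$. The order of $P^\star$ is $K^\star=\min\{K:P^\star\in\Pi_K\}$. $\lambda f=\int f\,d\lambda$. $M_1(\mathcal Z)$ is the set of probability measures on $\mathcal Z$. $H(P|Q)=\int\log(dP/dQ)\,dP$ if $P\ll Q$ and $+\infty$ otherwise; $H(P|\Pi)=\inf_{Q\in\Pi}H(P|Q)$, $H(\Pi|Q)=\inf_{P\in\Pi}H(P|Q)$. Given a penalty $\mathrm{pen}(n,K)>0$, $\mathrm{crit}(n,K)=\sup_{\theta\in\Theta_K}\sum_{i=1}^n\ell_\theta(Z_i)-\mathrm{pen}(n,K)$, $\widehat K_n^L=\inf\{K\ge1:\mathrm{crit}(n,K)\ge\mathrm{crit}(n,K+1)\}$, and $\widehat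 K_n^G$ is the smallest maximizer of $K\mapsto\mathrm{crit}(n,K)$. All suprema are assumed measurable. Standing assumptions: (A1) each $(\Theta_K,d)$ is compact and each $\Pi_K$ is compact for the weak topology; (A2) for each $z$ and $K$, $\theta\mapsto\ell_\theta(z)$ is continuous on $\Theta_K$; (A3) there are $l,u:\mathcal Z\to\mathbb R$ with $u-l\in L^1(P^\star)$, $l\le\ell^\star\le u$ and $l\le\ell_\theta\le u$ for all $\theta\in\Theta_\infty$; (A4) for each $n$, $\mathrm{pen}(n,\cdot)$ is increasing, and for each $K$, $\mathrm{pen}(n,K)\to\infty$ and $\mathrm{pen}(n,K)=o(n)$ as $n\to\infty$. Large-deviation framework: $\tau(s)=e^{|s|}-|s|-1$. $\mathcal L_\tau(P^\star)=\{f:\mathcal Z\to\mathbb R:\exists a>0,\ P^\star\tau(f/a)<\infty\}$ and $\mathcal M_\tau(P^\star)=\{f:\forall a>0,\ P^\star\tau(f/a)<\infty\}$; $\mathcal L_\tau(P^\star)$ is a Banach space with the norm $\|f\|_\tau=\inf\{a>0:P^\star\tau(f/a)\le1\}$, and $\mathcal L'_\tau(P^\star)$ is its topological dual. $\mathcal P=\{p^{-1}\sum_{i=1}^p\delta_{z_i}:p\ge1,z_i\in\mathcal Z\}$. $\mathcal Q=\{Q\in\mathcal L'_\tau(P^\star):Q\ge0,\ Q1=1\}\cup\mathcal P$, with the coarsest topology making $Q\mapsto Qf$ continuous for all $f\in\mathcal L_\tau(P^\star)$. For $\alpha\ge0$, $K\ge1$: $\Lambda_{\alpha,K}=\{Q\in\mathcal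 Q:\sup_{\theta\in\Theta_K}Q\ell_\theta-\sup_{\theta\in\Theta_{K+1}}Q\ell_\theta\ge-\alpha\}$ and $\Gamma_{\alpha,K}=\{Q\in\mathcal Q:\sup_{\theta\in\Theta_K}Q\ell_\theta-\sup_{\theta\in\Theta_{K^\star}}Q\ell_\theta\ge-\alpha\}$; $\Lambda_{0,K}\cap M_1(\mathcal Z)$ denotes the probability measures in $\mathcal L'_\tau(P^\star)$ belonging to $\Lambda_{0,K}$ (similarly for $\Gamma$). *)

(* Defs.v *)
From HB Require Import structures.
From mathcomp Require Import all_boot all_order all_algebra.
From mathcomp Require Import all_classical all_reals all_analysis.
From mathcomp Require Import measurable_realfun.
Set Implicit Arguments.
Unset Strict Implicit.
Unset Printing Implicit Defensive.
Import Order.TTheory GRing.Theory Num.Theory numFieldNormedType.Exports.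
Local Open Scope classical_set_scope.
Local Open Scope ring_scope.

Definition separable_space (T : topologicalType) : Prop :=
  exists D : set T, countable D /\ closure D = setT.

Notation borelType T := (g_sigma_algebraType (@open T)).

Definition densities d (T : measurableType d) (R : realType)
    (Q P : probability T R) : set (T -> R) :=
  [set g : T -> R | measurable_fun setT g /\ (forall x, 0 <= g x) /\
     forall A, measurable A -> Q A = (\int[P]_(x in A) (g x)%:E)%E].

(* H(Q|P) = int log(dQ/dP) dQ = int g log g dP if Q << P (g = dQ/dP),
   +oo otherwise (the infimum over an empty set of densities is +oo;
   all densities agree P-a.e., so the infimum is the common value). *)
Definition KL d (T : measurableType d) (R : realType)
    (Q P : probability T R) : \bar R :=
  ereal_inf [set (\int[P]_x ((g x) * ln (g x))%:E)%E | g in densities Q P].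

Definition KLset d (T : measurableType d) (R : realType)
    (A : set (probability T R)) (P : probability T R) : \bar R :=
  ereal_inf [set KL Q P | Q in A].

Definition bounded_continuous (T : topologicalType) (R : realType)
    (f : T -> R) : Prop :=
  continuous f /\ exists M : R, forall x, `|f x| <= M.

(* Q is a cluster point of F in the weak topology, i.e. the initial
   topology of the maps Q |-> Q f, f bounded continuous; basic
   neighbourhoods: finitely many f and one eps. *)
Definition weak_cluster (Z : ptopologicalType) (R : realType)
    (F : set_system (probability (borelType Z) R))
    (Q : probability (borelType Z) R) : Prop :=
  forall (fs : seq (Z -> R)) (eps : R), 0 < eps ->
    (forall f, f \in fs -> bounded_continuous f) ->
    forall B, F B -> exists Q', B Q' /\
      forall f, f \in fs ->
        (`| \int[Q']_x (f x)%:E - \int[Q]_x (f x)%:E | < eps%:E)%E.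

Definition weakly_compact (Z : ptopologicalType) (R : realType)
    (S : set (probability (borelType Z) R)) : Prop :=
  forall F : set_system (probability (borelType Z) R),
    ProperFilter F -> F S -> exists Q, S Q /\ weak_cluster F Q.

Definition tau (R : realType) (s : R) : R := expR `|s| - `|s| - 1.

Definition Ltau d (T : measurableType d) (R : realType)
    (P : probability T R) (f : T -> R) : Prop :=
  measurable_fun setT f /\
  exists a : R, 0 < a /\ (\int[P]_x (tau (f x / a))%:E < +oo)%E.

Definition Mtau d (T : measurableType d) (R : realType)
    (P : probability T R) (f : T -> R) : Prop :=
  measurable_fun setT f /\
  forall a : R, 0 < a -> (\int[P]_x (tau (f x / a))%:E < +oo)%E.

Definition tau_norm d (T : measurableType d) (R : realType)
    (P : probability T R) (f : T -> R) : R :=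
  inf [set a : R | 0 < a /\ (\int[P]_x (tau (f x / a))%:E <= 1)%E].

(* phi (a functional on functions, only its values on L_tau matter)
   is a continuous linear form on L_tau(P) *)
Definition in_dual d (T : measurableType d) (R : realType)
    (P : probability T R) (phi : (T -> R) -> R) : Prop :=
  (forall f g, Ltau P f -> Ltau P g -> phi (fun x => f x + g x) = phi f + phi g) /\
  (forall (c : R) f, Ltau P f -> phi (fun x => c * f x) = c * phi f) /\
  (exists C : R, forall f, Ltau P f -> `|phi f| <= C * tau_norm P f).

Definition Qset d (T : measurableType d) (R : realType)
    (P : probability T R) (phi : (T -> R) -> R) : Prop :=
  (in_dual P phi /\
   (forall f, Ltau P f -> {ae P, forall x, 0 <= f x} -> 0 <= phi f) /\
   phi (fun _ => 1) = 1)
  \/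
  (exists zs : seq T, (0 < size zs)%N /\
     phi = (fun f => (size zs)%:R^-1 * \sum_(z <- zs) f z)).

Definition prob_in_dual d (T : measurableType d) (R : realType)
    (P Q : probability T R) : Prop :=
  (forall f, Ltau P f -> Q.-integrable setT (fun x => (f x)%:E)) /\
  in_dual P (fun f => fine (\int[Q]_x (f x)%:E)).

Definition integral_functional d (T : measurableType d) (R : realType)
    (Q : probability T R) : (T -> R) -> R :=
  fun f => fine (\int[Q]_x (f x)%:E).

Definition supQ d (T : measurableType d) (R : realType) (Th : Type)
    (l : Th -> T -> R) (S : set Th) (phi : (T -> R) -> R) : \bar R :=
  ereal_sup [set (phi (l th))%:E | th in S].

Definition Lambda d (T : measurableType d) (R : realType) (Th : Type)
    (P : probability T R) (Theta : nat -> set Th) (l : Th -> T -> R)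
    (alpha : R) (K : nat) : set ((T -> R) -> R) :=
  [set phi | Qset P phi /\
     (supQ l (Theta K) phi - supQ l (Theta K.+1) phi >= - alpha%:E)%E].

Definition Gamma d (T : measurableType d) (R : realType) (Th : Type)
    (P : probability T R) (Theta : nat -> set Th) (l : Th -> T -> R)
    (Kstar : nat) (alpha : R) (K : nat) : set ((T -> R) -> R) :=
  [set phi | Qset P phi /\
     (supQ l (Theta K) phi - supQ l (Theta Kstar) phi >= - alpha%:E)%E].

(* A `&` M_1(Z): probability measures in L'_tau(P) belonging to A *)
Definition probs_in d (T : measurableType d) (R : realType)
    (P : probability T R) (A : set ((T -> R) -> R)) : set (probability T R) :=
  [set Q | prob_in_dual P Q /\ A (integral_functional Q)].

(* P in Pi_K  (Pi_0 is empty) *)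
Definition inPi d (T : measurableType d) (R : realType) (Th : Type)
    (Theta : nat -> set Th) (Pth : Th -> probability T R)
    (K : nat) (P : probability T R) : Prop :=
  (1 <= K)%N /\
  exists th, Theta K th /\ forall A, measurable A -> Pth th A = P A.

Definition KL_to_model d (T : measurableType d) (R : realType) (Th : Type)
    (Theta : nat -> set Th) (Pth : Th -> probability T R)
    (P : probability T R) (K : nat) : \bar R :=
  ereal_inf [set KL P (Pth th) | th in Theta K].

Definition Theta_inf (Th : Type) (Theta : nat -> set Th) : set Th :=
  [set th | exists K, (1 <= K)%N /\ Theta K th].

Definition is_norm (R : realType) (m : nat) (N : 'rV[R]_m -> R) : Prop :=
  (forall x, N x = 0 <-> x = 0) /\
  (forall (a : R) x, N (a *: x) = `|a| * N x) /\
  (forall x y, N (x + y) <= N x + N y).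

Definition N_interior (R : realType) (m : nat) (N : 'rV[R]_m -> R)
    (S : set 'rV[R]_m) (x : 'rV[R]_m) : Prop :=
  exists r : R, 0 < r /\ forall y, N (y - x) < r -> S y.

Definition dotv (R : realType) (m : nat) (a h : 'rV[R]_m) : R :=
  \sum_(i < m) a ord0 i * h ord0 i.

Definition crit d (T : measurableType d) (R : realType) (Th Omega : Type)
    (Theta : nat -> set Th) (l : Th -> T -> R) (pen : nat -> nat -> R)
    (Zs : nat -> Omega -> T) (n K : nat) (w : Omega) : \bar R :=
  (ereal_sup [set (\sum_(i < n) l th (Zs i w))%:E | th in Theta K]
    - (pen n K)%:E)%E.

(* event {hat K^L_n < Kstar}:
   hat K^L_n = inf {K >= 1 : crit(n,K) >= crit(n,K+1)} *)
Definition event_L d (T : measurableType d) (R : realType) (Th Omega : Type)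
    (Theta : nat -> set Th) (l : Th -> T -> R) (pen : nat -> nat -> R)
    (Zs : nat -> Omega -> T) (Kstar n : nat) : set Omega :=
  [set w | exists K, (1 <= K < Kstar)%N /\
     (crit Theta l pen Zs n K w >= crit Theta l pen Zs n K.+1 w)%E].

(* event {hat K^G_n < Kstar}: hat K^G_n is the smallest maximizer *)
Definition event_G d (T : measurableType d) (R : realType) (Th Omega : Type)
    (Theta : nat -> set Th) (l : Th -> T -> R) (pen : nat -> nat -> R)
    (Zs : nat -> Omega -> T) (Kstar n : nat) : set Omega :=
  [set w | exists K, (1 <= K < Kstar)%N /\
     (forall K', (1 <= K')%N ->
        (crit Theta l pen Zs n K' w <= crit Theta l pen Zs n K w)%E) /\
     (forall K', (1 <= K' < K)%N ->
        (crit Theta l pen Zs n K' w < crit Theta l pen Zs n K w)%E)].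

Definition log_rate dO (Omega : measurableType dO) (R : realType)
    (P : probability Omega R) (E : nat -> set Omega) (n : nat) : \bar R :=
  ((n%:R)^-1%:E * lne (P (E n)))%E.

(* Main.v *)
(** If an event [E] about the first [n] observations has probability at least
    [exp (- n r)], the law of a uniformly chosen observation conditioned on [E]
    has relative entropy at most [r] with respect to [P*], and every inequality
    [sum_i g (Z_i) >= n c] valid on [E] passes to its mean (Csiszar).
    Underestimation at [K] means that some [theta] of the smaller model beats, up
    to the penalty, every [theta'] of the larger one.  Since [up - lo] has all
    exponential moments, [theta] may be restricted to a finite net of the compact
    smaller model, at the price of a local oscillation whose mean is controlled
    by entropy, so a probability of order [exp (- n r)] yields [Q] of entropy at
    most [r] with [Q (l theta - l theta') >= - eps] for all [theta'].

    To let [eps] tend to [0], take a cluster point of the [theta] and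
    near-minimisers of the entropy over the resulting decreasing convex sets:
    strict convexity of [x ln x] makes their densities Cauchy in Hellinger
    distance, and Fatou's lemma applied to the defect in
    [x y <= x ln x - x + exp y] passes all the constraints to the limit.  The
    entropy infimum is therefore attained; were it [0], it would be attained at
    [P*] itself, contradicting the order of [P*]. *)
Require Import Defs.
From HB Require Import structures.
From mathcomp Require Import all_boot all_order all_algebra.
From mathcomp Require Import all_classical all_reals all_analysis.
From mathcomp Require Import measurable_realfun.
From mathcomp Require Import ring lra zify.
Import Order.TTheory GRing.Theory Num.Theory numFieldNormedType.Exports.
Local Open Scope classical_set_scope.
Local Open Scope ring_scope.

Set Implicit Arguments.
Unset Strict Implicit.

(** * Convexity of [x ln x], measured in Hellinger distance *)

Section xlnx.
Context {R : realType}.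
Implicit Types x y a b s : R.

(** [Lambda] and [Gamma] are cut out by a difference of two suprema, each convex in [Q], so in
    general they are neither convex nor given by linear constraints. Fixing the maximising parameter
    of the smaller model restores both properties, which is why compactness of the parameter set is
    exploited before any limit of measures is taken. The limit must preserve means of unbounded
    functions: differences of log-likelihoods are controlled only by the envelope [up - lo], whose
    exponential moments pair with entropy through Fenchel-Young. That single inequality, tested with
    all constants and with all multiples [a g], yields the entropy bound, conservation of mass and
    the constraints of the limit. A likely event directly produces a probability measure with a
    density, hence a bound by entropies over [M_1(Z)] alone. Rates are always compared strictly: the
    gap between two rates pays for the cardinality of finite nets. *)

Definition xlnx x : R := x * ln x.

(* Fenchel-Young for the convex pair [x ln x - x] and [exp]. *)
Lemma xlnx_young x y : 0 <= x -> x * y <= xlnx x - x + expR y.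
Proof.
rewrite /xlnx le_eqVlt => /orP[/eqP <-|x0].
  by rewrite !mul0r subrr add0r expR_ge0.
have -> : expR y = x * expR (y - ln x) by rewrite expRB lnK// mulrCA divff ?mulr1 ?gt_eqF.
have := ler_wpM2l (ltW x0) (expR_ge1Dx (y - ln x)).
by rewrite mulrDr mulrBr; lra.
Qed.

Lemma xlnx_ge_subr1 x : 0 <= x -> x - 1 <= xlnx x.
Proof. by move=> x0; have := xlnx_young 0 x0; rewrite expR0; lra. Qed.

Lemma xlnx_ge_N1 x : 0 <= x -> -1 <= xlnx x.
Proof. by move=> x0; have := xlnx_ge_subr1 x0; lra. Qed.

(** The right side is the Bregman divergence of [x ln x]. With [x], [y] the square roots of [a],
    [s], it equals [2 x^2 ln (x / y) - x^2 + y^2], and [ln (y / x) <= y / x - 1] bounds it below by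
    a square. *)
Lemma xlnx_tangent_hellinger a s : 0 <= a -> 0 < s ->
  (Num.sqrt a - Num.sqrt s) ^+ 2 <= xlnx a - a * ln s - a + s.
Proof.
rewrite /xlnx le_eqVlt => /orP[/eqP <- s0|a0 s0].
  by rewrite sqrtr0 sub0r sqrrN sqr_sqrtr ?(ltW s0)// !mul0r; lra.
set x := Num.sqrt a; set y := Num.sqrt s.
have x0 : 0 < x by rewrite sqrtr_gt0.
have y0 : 0 < y by rewrite sqrtr_gt0.
have aE : a = x ^+ 2 by rewrite sqr_sqrtr// ltW.
have sE : s = y ^+ 2 by rewrite sqr_sqrtr// ltW.
rewrite aE sE !lnXn// -![ln _ *+ 2]mulr_natl.
have : ln (y / x) <= y / x - 1.
  have h : -1 < y / x - 1 by rewrite -subr_gt0 opprK subrK divr_gt0.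
  by have := le_ln1Dx h; rewrite addrC subrK.
rewrite ln_div ?posrE// => h.
have := ler_wpM2l (ltW (exprn_gt0 2 x0)) h.
have yE : y = y / x * x by rewrite divfK// gt_eqF.
move: yE; move: (y / x) (ln x) (ln y) => w lx ly yE; rewrite yE; nra.
Qed.

(** Adding the tangent inequalities of [a] and [b] at their midpoint cancels the linear terms; the
    parallelogram identity then eliminates the root of the midpoint. *)
Lemma xlnx_midpoint_gap a b : 0 <= a -> 0 <= b ->
  (Num.sqrt a - Num.sqrt b) ^+ 2 / 2 <= xlnx a + xlnx b - 2 * xlnx ((a + b) / 2).
Proof.
move=> a0 b0; have [s0|] := ltP 0 ((a + b) / 2); last first.
  move=> ab; have -> : a = 0 by lra.
  have -> : b = 0 by lra.
  by rewrite /xlnx !(addr0, mul0r, mulr0, subrr) expr0n /= mul0r.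
have ha := xlnx_tangent_hellinger a0 s0.
have hb := xlnx_tangent_hellinger b0 s0.
have : xlnx a + xlnx b - 2 * xlnx ((a + b) / 2) =
  (xlnx a - a * ln ((a + b) / 2) - a + (a + b) / 2) +
  (xlnx b - b * ln ((a + b) / 2) - b + (a + b) / 2).
  by rewrite /xlnx; field.
move=> ->; move: ha hb.
move: (Num.sqrt a) (Num.sqrt b) (Num.sqrt ((a + b) / 2)) => x y z ha hb.
apply: le_trans (lerD ha hb).
have := sqr_ge0 (x + y - 2 * z).
have -> : (x - z) ^+ 2 + (y - z) ^+ 2 = (x - y) ^+ 2 / 2 + (x + y - 2 * z) ^+ 2 / 2 by field.
by move=> ?; lra.
Qed.

(** These bounds squeeze [xlnx] to [0] at [0], where [ln] itself is not continuous; the lower one is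
    [ln y < y] at [y = 1 / sqrt x]. *)
Lemma xlnx_bounds x : 0 <= x -> - (2 * Num.sqrt x) <= xlnx x <= x ^+ 2.
Proof.
rewrite /xlnx le_eqVlt => /orP[/eqP <-|x0].
  by rewrite sqrtr0 mulr0 oppr0 mul0r lexx expr0n lexx.
set y := Num.sqrt x; have y0 : 0 < y by rewrite sqrtr_gt0.
have xE : x = y ^+ 2 by rewrite sqr_sqrtr// ltW.
apply/andP; split; last first.
  by rewrite expr2 ler_wpM2l ?(ltW x0)// ltW// ln_sublinear.
have yV0 : 0 < y^-1 by rewrite invr_gt0.
have := ln_sublinear yV0; rewrite lnV ?posrE// => h.
have := ler_wpM2l (ltW x0) (ltW h).
have -> : x * y^-1 = y by rewrite xE expr2 mulfK// gt_eqF.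
by rewrite {3}xE lnXn// -[ln _ *+ 2]mulr_natl; lra.
Qed.

Lemma cvg_xlnx (u : nat -> R) (v : R) : (forall n, 0 <= u n) -> 0 <= v ->
  u @ \oo --> v -> xlnx (u n) @[n --> \oo] --> xlnx v.
Proof.
move=> u0; rewrite le_eqVlt => /orP[/eqP <- uv|v0 uv]; last first.
  apply: cvgM => //; apply: continuous_cvg => //; exact: continuous_ln.
rewrite /xlnx mul0r; apply: (@squeeze_cvgr _ _ _ _ (fun n => - (2 * Num.sqrt (u n))) (fun n => u n ^+ 2)).
- by apply: nearW => n; exact: xlnx_bounds.
- rewrite -oppr0; apply: cvgN; rewrite -(mulr0 2).
  apply: cvgM; first exact: cvg_cst.
  rewrite -(@sqrtr0 R); apply: continuous_cvg => //; exact: sqrt_continuous.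
- by rewrite -(mulr0 0); apply: cvgM.
Qed.

Lemma measurable_fun_xlnx d (T : measurableType d) (f : T -> R) :
  measurable_fun setT f -> measurable_fun setT (fun z => xlnx (f z)).
Proof.
move=> mf; apply: measurable_funM => //.
exact: measurableT_comp.
Qed.

End xlnx.

(** * Real-valued integrals under a probability measure *)

Section real_integrals.
Context d (T : measurableType d) (R : realType) (P : probability T R).
Implicit Types f g : T -> R.

Lemma rintegrable_measurable f : P.-integrable setT (EFin \o f) -> measurable_fun setT f.
Proof. by move=> /integrableP[/measurable_EFinP]. Qed.

Lemma rintegrable_dominated f g : measurable_fun setT f ->
  P.-integrable setT (EFin \o g) -> (forall x, `|f x| <= g x) ->
  P.-integrable setT (EFin \o f).
Proof.
move=> mf ig fg; apply: le_integrable ig => //; first exact/measurable_EFinP.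
by move=> x _ /=; rewrite lee_fin (le_trans (fg x))// ler_norm.
Qed.

Lemma rintegrable_ge0 f : measurable_fun setT f -> (forall x, 0 <= f x) ->
  (\int[P]_x (f x)%:E < +oo)%E -> P.-integrable setT (EFin \o f).
Proof.
move=> mf f0 foo; apply/integrableP; split; first exact/measurable_EFinP.
by under eq_integral do rewrite /= ger0_norm//.
Qed.

Lemma rintegrable_cst (c : R) : P.-integrable setT (EFin \o (fun=> c)).
Proof. exact: finite_measure_integrable_cst. Qed.

Lemma rintegrableD f g : P.-integrable setT (EFin \o f) ->
  P.-integrable setT (EFin \o g) -> P.-integrable setT (EFin \o (fun x => f x + g x)).
Proof. by move=> hf hg; exact: (integrableD measurableT hf hg). Qed.

Lemma rintegrableB f g : P.-integrable setT (EFin \o f) ->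
  P.-integrable setT (EFin \o g) -> P.-integrable setT (EFin \o (fun x => f x - g x)).
Proof. by move=> hf hg; exact: (integrableB measurableT hf hg). Qed.

Lemma rintegrableZ c f : P.-integrable setT (EFin \o f) ->
  P.-integrable setT (EFin \o (fun x => c * f x)).
Proof. by move=> hf; exact: (integrableZl measurableT c hf). Qed.

Lemma EFin_Rintegral f : P.-integrable setT (EFin \o f) ->
  (\int[P]_x f x)%:E = (\int[P]_x (f x)%:E)%E.
Proof. by move=> hf; rewrite fineK//; apply: integrable_fin_num. Qed.

Lemma Rintegral_probability_cst (c : R) : \int[P]_x c = c.
Proof.
rewrite Rintegral_cst//.
rewrite [X in fine X](_ : _ = 1%E) ?mulr1//; exact: probability_setT.
Qed.

Lemma Rintegral_combine f g c : P.-integrable setT (EFin \o f) ->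
  P.-integrable setT (EFin \o g) ->
  \int[P]_x (f x - c * g x) = \int[P]_x f x - c * \int[P]_x g x.
Proof.
by move=> hf hg; rewrite RintegralB// ?RintegralZl//; exact: rintegrableZ.
Qed.

(** [Rintegral] sends an infinite integral to [0], so a bound on it means little without
    integrability. Both are delivered together, after a proof in the extended reals. *)
Lemma rfatou (F : nat -> T -> R) (G : T -> R) (c : R) :
  (forall n, P.-integrable setT (EFin \o F n)) -> (forall n x, 0 <= F n x) ->
  measurable_fun setT G -> (forall x, 0 <= G x) ->
  {ae P, forall x, (F n x) @[n --> \oo] --> G x} ->
  (forall e : R, 0 < e -> \forall n \near \oo, \int[P]_x F n x <= c + e) ->
  P.-integrable setT (EFin \o G) /\ \int[P]_x G x <= c.
Proof.
move=> iF F0 mG G0 FG Fc.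
have mF n : measurable_fun setT (EFin \o F n) by case/integrableP: (iF n).
have h : (\int[P]_x (G x)%:E <= c%:E)%E.
  rewrite (@ae_eq_integral _ _ _ P setT (fun x => limn_einf (fun n => (F n x)%:E)))//.
  - apply: le_trans (fatou _ _ _ _) _ => //.
      by move=> n x _; rewrite lee_fin.
    apply/lee_addgt0Pr => e e0; rewrite -EFinD limn_einf_lim.
    have [N _ hN] := Fc _ e0.
    apply: lime_le; first exact: is_cvg_einfs.
    exists N => // n Nn; apply: (@le_trans _ _ (\int[P]_x (F n x)%:E)%E).
      by apply: ereal_inf_lbound; exists n => /=.
    by rewrite -EFin_Rintegral// lee_fin hN.
  - exact/measurable_EFinP.
  - rewrite [X in measurable_fun _ X](_ : _ =
        (fun x => - limn_esup (fun n => - (F n x)%:E))%E); last first.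
      apply/funext => x; rewrite -limn_einfN; congr limn_einf.
      by apply/funext => n /=; rewrite opprK.
    apply: measurableT_comp => //; apply: measurable_fun_limn_esup => n.
    exact: (measurableT_comp (@oppe_measurable _ _) (mF n)).
  - apply: filterS FG => x Fx _; apply/esym.
    have /cvg_limn_einf_sup[->] : (F n x)%:E @[n --> \oo] --> (G x)%:E by apply: cvg_EFin => //; exact: nearW.
    by [].
split; first by apply: rintegrable_ge0 => //; exact: le_lt_trans h (ltry _).
have iG : P.-integrable setT (EFin \o G).
  by apply: rintegrable_ge0 => //; exact: le_lt_trans h (ltry _).
by rewrite -lee_fin EFin_Rintegral.
Qed.

End real_integrals.

(** * Densities of bounded entropy and their limits *)

Section entropy_density.
Context d (T : measurableType d) (R : realType) (P : probability T R).
Implicit Types (q g : T -> R) (r : R).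

(** Integrability of [xlnx (q x)] is a separate field because the default value of the real integral
    could otherwise make the entropy bound vacuous. *)
Record entropy_density r q : Prop := EntropyDensity {
  ed_measurable : measurable_fun setT q;
  ed_ge0 : forall x, 0 <= q x;
  ed_integrable : P.-integrable setT (EFin \o q);
  ed_mass : \int[P]_x q x = 1;
  ed_xlnx_integrable : P.-integrable setT (EFin \o (fun x => xlnx (q x)));
  ed_xlnx_le : \int[P]_x xlnx (q x) <= r }.

(** By Fenchel-Young these functions are integrable against every density of finite entropy, and
    lower bounds on their means survive the limits below. The class contains [M_tau]. *)
Definition all_exp_moments g : Prop := measurable_fun setT g /\
  forall a, 0 < a -> P.-integrable setT (EFin \o (fun x => expR (a * `|g x|))).

Lemma entropy_density_weaken r r' q : r <= r' ->
  entropy_density r q -> entropy_density r' q.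
Proof. by move=> rr' [? ? ? ? ? ?]; split => //; exact: le_trans rr'. Qed.

(** Fenchel-Young at [y = a * g x], integrated and divided by [a]; mass one produces the [- 1]. A
    large [a] makes the bound small as long as the exponential moment stays bounded. *)
Lemma entropy_density_moment r q g a : entropy_density r q ->
  measurable_fun setT g -> (forall x, 0 <= g x) -> 0 < a ->
  P.-integrable setT (EFin \o (fun x => expR (a * g x))) ->
  P.-integrable setT (EFin \o (fun x => q x * g x)) /\
  \int[P]_x (q x * g x) <= a^-1 * (r + \int[P]_x expR (a * g x) - 1).
Proof.
move=> [mq q0 iq q1 ixq qr] mg g0 a0 ie.
have ih : P.-integrable setT
    (EFin \o (fun x => a^-1 * (xlnx (q x) - q x + expR (a * g x)))).
  by apply/rintegrableZ/rintegrableD => //; exact: rintegrableB.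
have le x : q x * g x <= a^-1 * (xlnx (q x) - q x + expR (a * g x)).
  rewrite ler_pdivlMl// mulrCA; exact: xlnx_young.
have ig : P.-integrable setT (EFin \o (fun x => q x * g x)).
  apply: rintegrable_dominated ih _; first exact: measurable_funM.
  by move=> x; rewrite ger0_norm// mulr_ge0.
split=> //.
apply: le_trans (le_Rintegral measurableT ig ih (fun x _ => le x)) _.
rewrite RintegralZl//; last by apply: rintegrableD => //; exact: rintegrableB.
rewrite ler_pM2l ?invr_gt0// RintegralD//; last exact: rintegrableB.
by rewrite RintegralB// q1; lra.
Qed.

Lemma all_exp_moments_integrable g a : all_exp_moments g ->
  P.-integrable setT (EFin \o (fun x => expR (a * g x))).
Proof.
move=> [mg eg].
have [->|a0] := eqVneq a 0.
  rewrite (_ : (fun x => _) = fun=> 1); first exact: rintegrable_cst.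
  by apply/funext => x; rewrite mul0r expR0.
apply: rintegrable_dominated (eg `|a| _) _; last 2 first.
- by rewrite normr_gt0.
- by move=> x; rewrite ger0_norm ?expR_ge0// ler_expR -normrM ler_norm.
- by apply: measurableT_comp => //; exact: measurable_funM.
Qed.

Lemma all_exp_moments_dominated g h : measurable_fun setT g ->
  all_exp_moments h -> (forall x, `|g x| <= h x) -> all_exp_moments g.
Proof.
move=> mg [mh eh] gh; split=> // a a0.
apply: rintegrable_dominated (eh a a0) _.
  apply: measurableT_comp => //; apply: measurable_funM => //.
  exact: measurableT_comp.
move=> x; rewrite ger0_norm ?expR_ge0// ler_expR; apply: ler_wpM2l; first exact: ltW.
exact: le_trans (gh x) (ler_norm _).
Qed.

Lemma entropy_density_integrable r q g : entropy_density r q ->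
  all_exp_moments g -> P.-integrable setT (EFin \o (fun x => q x * g x)).
Proof.
move=> hq [mg eg].
have [||||h _] := @entropy_density_moment r q (fun x => `|g x|) 1 hq.
- exact: measurableT_comp.
- by [].
- by [].
- exact: eg.
- apply: rintegrable_dominated h _.
    apply: measurable_funM => //; exact: ed_measurable hq.
  by move=> x; rewrite normrM ger0_norm//; exact: ed_ge0 hq _.
Qed.

(** * Almost everywhere limits of densities, with [r] the asymptotic entropy bound *)

Section limit.
Variables (u : nat -> T -> R) (q : T -> R) (r h : R).
Hypothesis hu : forall k, entropy_density h (u k).
Hypothesis ur : forall e : R, 0 < e -> \forall k \near \oo, \int[P]_x xlnx (u k x) <= r + e.
Hypothesis mq : measurable_fun setT q.
Hypothesis q0 : forall x, 0 <= q x.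
Hypothesis uq : {ae P, forall x, (u n x) @[n --> \oo] --> q x}.

(* Fatou applied to the nonnegative defect in the Fenchel-Young inequality. *)
Let young_limit (Y : T -> R) (c : R) : measurable_fun setT Y ->
  P.-integrable setT (EFin \o (fun x => expR (Y x))) ->
  (forall k, P.-integrable setT (EFin \o (fun x => u k x * Y x))) ->
  (forall e : R, 0 < e -> \forall k \near \oo, c - e <= \int[P]_x (u k x * Y x)) ->
  P.-integrable setT (EFin \o (fun x => xlnx (q x) - q x + expR (Y x) - q x * Y x)) /\
  \int[P]_x (xlnx (q x) - q x + expR (Y x) - q x * Y x) <= r - 1 + \int[P]_x expR (Y x) - c.
Proof.
move=> mY ie iuY uc.
have i1 k : P.-integrable setT (EFin \o (fun x => xlnx (u k x) - u k x)).
  by apply: rintegrableB; [exact: ed_xlnx_integrable (hu k)|exact: ed_integrable (hu k)].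
have i2 k : P.-integrable setT (EFin \o (fun x => xlnx (u k x) - u k x + expR (Y x))).
  exact: rintegrableD.
apply: (@rfatou _ _ _ P (fun k x => xlnx (u k x) - u k x + expR (Y x) - u k x * Y x)).
- by move=> k; exact: rintegrableB.
- by move=> k x; rewrite subr_ge0 xlnx_young//; exact: ed_ge0 (hu k) _.
- apply: measurable_funB; last exact: measurable_funM.
  apply: measurable_funD; last exact: measurableT_comp.
  by apply: measurable_funB => //; exact: measurable_fun_xlnx.
- by move=> x; rewrite subr_ge0 xlnx_young.
- apply: filterS uq => x ux.
  apply: cvgB; last by apply: cvgM => //; exact: cvg_cst.
  apply: cvgD; last exact: cvg_cst.
  apply: cvgB => //; apply: cvg_xlnx => // k; exact: ed_ge0 (hu k) _.
- move=> e e0; have e20 : 0 < e / 2 by rewrite divr_gt0.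
  near=> k.
  rewrite RintegralB// RintegralD// RintegralB ?(ed_mass (hu k))//;
    [|exact: ed_xlnx_integrable (hu k)|exact: ed_integrable (hu k)].
  have h1 : \int[P]_x xlnx (u k x) <= r + e / 2 by near: k; exact: ur.
  have h2 : c - e / 2 <= \int[P]_x (u k x * Y x) by near: k; exact: uc.
  by rewrite (_ : r - 1 + _ - c + e = (r + e / 2) - 1 + \int[P]_x expR (Y x) - (c - e / 2));
    [lra|field].
Unshelve. all: by end_near. Qed.

(** Against a constant test function the mean is exactly [c], since each [u k] has mass one. *)
Let cst_limit (c : R) :
  P.-integrable setT (EFin \o (fun x => xlnx (q x) - q x + expR c - q x * c)) /\
  \int[P]_x (xlnx (q x) - q x + expR c - q x * c) <= r - 1 + expR c - c.
Proof.
have /(_ _ _ _ _)[] := @young_limit (fun=> c) c.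
- exact: measurable_cst.
- exact: (rintegrable_cst P (expR c)).
- move=> k; rewrite (_ : (fun x => _) = (fun x => c * u k x)).
    exact/rintegrableZ/ed_integrable.
  by apply/funext => x; rewrite mulrC.
- move=> e e0; apply: nearW => k.
  rewrite RintegralZr//; last exact: ed_integrable (hu k).
  by rewrite (ed_mass (hu k)) mul1r; lra.
- by move=> ? ?; split => //; rewrite -[X in _ + X - _](Rintegral_probability_cst P).
Qed.

(** Testing with every constant [c] gives [(c + 1) (1 - m) <= r - H], where [m] is the mass and [H]
    the entropy of the limit. The left side is affine in [c], so [m = 1]: no mass escapes. *)
Lemma entropy_density_limit : entropy_density r q.
Proof.
have [i0 l0] := cst_limit 0; have [i1 l1] := cst_limit 1.
(* The defects at the constants [0] and [1] differ by [q] up to a constant. *)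
have iq : P.-integrable setT (EFin \o q).
  have := rintegrableD (rintegrableB i0 i1) (rintegrable_cst P (expR 1 - expR 0)).
  congr (_.-integrable _ (_ \o _)); apply/funext => x.
  by rewrite mulr0 mulr1; ring.
have ixq : P.-integrable setT (EFin \o (fun x => xlnx (q x))).
  have := rintegrableD (rintegrableD i0 iq) (rintegrable_cst P (- expR 0)).
  congr (_.-integrable _ (_ \o _)); apply/funext => x.
  by rewrite mulr0; ring.
have le c : \int[P]_x xlnx (q x) - \int[P]_x q x + expR c - c * \int[P]_x q x <=
    r - 1 + expR c - c.
  have [_] := cst_limit c.
  rewrite RintegralB//; last first.
    by rewrite (_ : (fun x => _) = (fun x => c * q x));
      [exact: rintegrableZ|apply/funext => x; rewrite mulrC].
    by apply: rintegrableD; [exact: rintegrableB|exact: rintegrable_cst].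
  rewrite RintegralD//; [|exact: rintegrableB|exact: rintegrable_cst].
  by rewrite RintegralB// RintegralZr// Rintegral_probability_cst [c * _]mulrC.
have q1 : \int[P]_x q x = 1.
  set m := \int[P]_x q x in le *; set H := \int[P]_x xlnx (q x) in le *.
  have le' c : (c + 1) * (1 - m) <= r - H by have := le c; lra.
  have [//|m1] := eqVneq m 1.
  have m1' : 1 - m != 0 by rewrite subr_eq0 eq_sym.
  have := le' ((r - H + 1) / (1 - m) - 1).
  by rewrite subrK divfK//; lra.
split => //; have := le 0; rewrite q1; lra.
Qed.

(** With [a g] as test function the exponential terms cancel and leave [a (c - m) <= r - H] for
    every [a > 0], where [m] is the mean of [g] in the limit; letting [a] grow forces [c <= m]. *)
Lemma entropy_density_limit_moment (g : T -> R) (c : R) : all_exp_moments g ->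
  (forall e : R, 0 < e -> \forall k \near \oo, c - e <= \int[P]_x (u k x * g x)) ->
  c <= \int[P]_x (q x * g x).
Proof.
move=> eg uc.
have hq := entropy_density_limit.
have ig := entropy_density_integrable hq eg.
have le a : 0 < a -> \int[P]_x xlnx (q x) - a * \int[P]_x (q x * g x) <= r - a * c.
  move=> a0.
  have /(_ _ _ _ _)[] := @young_limit (fun x => a * g x) (a * c).
  - by apply: measurable_funM => //; case: eg.
  - exact: all_exp_moments_integrable.
  - move=> k; rewrite (_ : (fun x => _) = (fun x => a * (u k x * g x))).
      by apply: rintegrableZ; exact: entropy_density_integrable (hu k) eg.
    by apply/funext => x; rewrite mulrCA.
  - move=> e e0; have := uc (e / a) (divr_gt0 e0 a0).
    apply: filterS => k.
    under [X in _ -> _ <= X]eq_Rintegral do rewrite mulrCA.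
    rewrite RintegralZl//; last exact: entropy_density_integrable (hu k) eg.
    by move=> /(ler_wpM2l (ltW a0)); rewrite mulrBr [a * (e / a)]mulrC divfK ?gt_eqF.
  - move=> _.
    have E : (fun x => q x * (a * g x)) = (fun x => a * (q x * g x)).
      by apply/funext => x; rewrite mulrCA.
    have ie := all_exp_moments_integrable a eg.
    rewrite RintegralB//; last 2 first.
    + apply: rintegrableD => //; apply: rintegrableB.
        exact: ed_xlnx_integrable hq.
      exact: ed_integrable hq.
    + by rewrite E; exact: rintegrableZ.
    rewrite RintegralD//; last first.
      by apply: rintegrableB; [exact: ed_xlnx_integrable hq|exact: ed_integrable hq].
    rewrite RintegralB//; [|exact: ed_xlnx_integrable hq|exact: ed_integrable hq].
    by rewrite (ed_mass hq) E RintegralZl//; lra.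
rewrite leNgt; apply/negP => lt.
set m := \int[P]_x (q x * g x) in le lt.
set H := \int[P]_x xlnx (q x) in le.
have cm0 : 0 < c - m by rewrite subr_gt0.
have h0 : 0 < (`|r - H| + 1) / (c - m).
  by rewrite divr_gt0// ltr_pwDr.
have := le _ h0; have := ler_norm (r - H).
have : (`|r - H| + 1) / (c - m) * (c - m) = `|r - H| + 1 by rewrite divfK ?gt_eqF.
by rewrite mulrBr; lra.
Qed.

End limit.

Lemma entropy_density_midpoint r q1 q2 :
  entropy_density r q1 -> entropy_density r q2 ->
  [/\ entropy_density r (fun x => (q1 x + q2 x) / 2),
      P.-integrable setT (EFin \o (fun x => (Num.sqrt (q1 x) - Num.sqrt (q2 x)) ^+ 2)) &
      \int[P]_x ((Num.sqrt (q1 x) - Num.sqrt (q2 x)) ^+ 2) / 2 <=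
      \int[P]_x xlnx (q1 x) + \int[P]_x xlnx (q2 x)
       - 2 * \int[P]_x xlnx ((q1 x + q2 x) / 2)].
Proof.
move=> [m1 p1 i1 e1 x1 r1] [m2 p2 i2 e2 x2 r2].
pose q x := (q1 x + q2 x) / 2; rewrite -/(q _).
have q0 x : 0 <= q x by rewrite divr_ge0// addr_ge0.
have qE : q = fun x => 2^-1 * (q1 x + q2 x) by apply/funext => x; rewrite mulrC.
have iq : P.-integrable setT (EFin \o q).
  by rewrite qE; apply: rintegrableZ; exact: rintegrableD.
have mq := rintegrable_measurable iq.
have gap x := xlnx_midpoint_gap (p1 x) (p2 x).
have gap0 x : xlnx (q x) <= 2^-1 * (xlnx (q1 x) + xlnx (q2 x)).
  have := gap x; rewrite -/(q x) => h.
  by have := sqr_ge0 (Num.sqrt (q1 x) - Num.sqrt (q2 x)); lra.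
have ixq : P.-integrable setT (EFin \o (fun x => xlnx (q x))).
  (* The shift [2] suffices because all values of [xlnx] are at least [-1]. *)
  apply: (@rintegrable_dominated _ _ _ P _
      (fun x => 2^-1 * (xlnx (q1 x) + xlnx (q2 x)) + 2)).
  - exact: measurable_fun_xlnx.
  - by apply: rintegrableD; [apply/rintegrableZ/rintegrableD|exact: rintegrable_cst].
  - move=> x; rewrite ler_norml.
    have := gap0 x; have := xlnx_ge_N1 (q0 x).
    have := xlnx_ge_N1 (p1 x); have := xlnx_ge_N1 (p2 x).
    move: (xlnx _) (xlnx _) (xlnx _) => A B C ? ? ? ?.
    by apply/andP; split; lra.
have iR : P.-integrable setT (EFin \o
    (fun x => 2 * (xlnx (q1 x) + xlnx (q2 x) - 2 * xlnx (q x)))).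
  by apply/rintegrableZ/rintegrableB; [exact: rintegrableD|exact: rintegrableZ].
have le x : (Num.sqrt (q1 x) - Num.sqrt (q2 x)) ^+ 2 <=
    2 * (xlnx (q1 x) + xlnx (q2 x) - 2 * xlnx (q x)).
  by have := gap x; rewrite -/(q x); lra.
have iD : P.-integrable setT (EFin \o (fun x => (Num.sqrt (q1 x) - Num.sqrt (q2 x)) ^+ 2)).
  apply: rintegrable_dominated iR _; last first.
    by move=> x; rewrite ger0_norm// sqr_ge0.
  have ms (f : T -> R) : measurable_fun setT f -> measurable_fun setT (fun x : T => Num.sqrt (f x)).
    move=> mf; apply: measurableT_comp mf.
    apply: continuous_measurable_fun; exact: sqrt_continuous.
  by apply: measurable_funX; apply: measurable_funB; exact: ms.
split => //.
- split => //.
  + change (\int[P]_x q x = 1).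
    by rewrite qE RintegralZl//; [rewrite RintegralD// e1 e2; lra|exact: rintegrableD].
  + apply: le_trans (le_Rintegral measurableT ixq _ (fun x _ => gap0 x)) _.
      by apply/rintegrableZ/rintegrableD.
    by rewrite RintegralZl//; [rewrite RintegralD//; lra|exact: rintegrableD].
- have := le_Rintegral measurableT iD iR (fun x _ => le x).
  rewrite RintegralZl//; last by apply: rintegrableB; [exact: rintegrableD|exact: rintegrableZ].
  by rewrite Rintegral_combine//; [rewrite RintegralD//; lra|exact: rintegrableD].
Qed.

End entropy_density.

(** * Entropy minimisation under linear constraints *)

Lemma geometric_increments_cvg (R : realType) (s : nat -> R) (C : R) :
  (forall k, `|s k.+1 - s k| <= C / 2 ^+ k) -> cvgn s.
Proof.
move=> h.
have C0 : 0 <= C by have := le_trans (normr_ge0 _) (h 0%N); rewrite expr0 divr1.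
have hs : cvgn (series (telescope s)).
  apply: normed_cvg; apply: (@series_le_cvg _ _ (geometric C 2^-1)).
  - by move=> n; exact: normr_ge0.
  - by move=> n; rewrite /geometric /= mulr_ge0// exprn_ge0// invr_ge0.
  - by move=> n; rewrite /geometric /= /telescope exprVn; exact: h.
  - by apply: is_cvg_geometric_series; rewrite ger0_norm ?invf_lt1// ltr1n.
rewrite (_ : s = (fun n => s 0%N + series (telescope s) n)).
  by apply: is_cvgD => //; exact: is_cvg_cst.
by apply/funext => n; exact: eq_sum_telescope.
Qed.

Section entropy_closure.
Context d (T : measurableType d) (R : realType) (P : probability T R).
Implicit Types (q g : T -> R) (r : R).

(** Weighted by [4 ^ k], the squared increments of the square roots have an integrable sum [G].
    Where [G] is finite the increments are at most [sqrt G / 2 ^ k], so the roots converge. *)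
Lemma hellinger_cauchy_ae_limit (u : nat -> T -> R) :
  (forall k, measurable_fun setT (u k)) -> (forall k x, 0 <= u k x) ->
  (forall k, P.-integrable setT
    (EFin \o (fun x => (Num.sqrt (u k.+1 x) - Num.sqrt (u k x)) ^+ 2))) ->
  (forall k, 4 ^+ k * \int[P]_x ((Num.sqrt (u k.+1 x) - Num.sqrt (u k x)) ^+ 2)
     <= 1 / (2 ^ k.+1)%:R) ->
  exists q, [/\ measurable_fun setT q, forall x, 0 <= q x &
    {ae P, forall x, (u n x) @[n --> \oo] --> q x}].
Proof.
move=> mu u0 iD hD.
pose s k x := Num.sqrt (u k x).
pose D k x := 4 ^+ k * (s k.+1 x - s k x) ^+ 2.
have ms k : measurable_fun setT (s k).
  apply: measurableT_comp (mu k).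
  apply: continuous_measurable_fun; exact: sqrt_continuous.
have D0 k x : 0 <= D k x by apply: mulr_ge0; [exact: exprn_ge0|exact: sqr_ge0].
have iD' k : P.-integrable setT (EFin \o D k) by exact: (rintegrableZ (4 ^+ k) (iD k)).
have mD k : measurable_fun setT (EFin \o D k).
  by case/integrableP: (iD' k).
pose G x := (\sum_(0 <= k <oo) (D k x)%:E)%E.
have mG : measurable_fun setT G.
  have D0' k x : setT x -> xpredT k -> (0 <= (D k x)%:E)%E by rewrite lee_fin.
  exact: (ge0_emeasurable_sum D0' (fun k _ => mD k)).
have G0 x : (0 <= G x)%E by apply: nneseries_ge0 => k _ _; rewrite lee_fin.
have iG : P.-integrable setT G.
  apply/integrableP; split => //.
  under eq_integral do rewrite gee0_abs//.
  rewrite integral_nneseries//; last by move=> k x _; rewrite lee_fin.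
  apply: (@le_lt_trans _ _ (1%:E : \bar R)%E); last by rewrite ltry.
  apply: le_trans (@epsilon_trick0 R 1 xpredT ler01).
  apply: lee_nneseries => k _.
    by move=> _; apply: integral_ge0 => x _; rewrite lee_fin.
  rewrite -EFin_Rintegral// lee_fin (RintegralZl _ measurableT (iD k)).
  exact: hD.
(* A limsup is measurable and defined everywhere; it is the limit on the almost sure convergence
   set. *)
pose lims x := limn_esup (fun k => (s k x)%:E).
have mlims : measurable_fun setT lims.
  by apply: measurable_fun_limn_esup => k; exact/measurable_EFinP.
exists (fun x => fine (lims x) ^+ 2); split.
- by apply: measurable_funX; exact: measurableT_comp.
- by move=> x; rewrite sqr_ge0.
- apply: filterS (integrable_ae measurableT iG) => x /(_ Logic.I) Gfin.
  have cs : cvgn (s^~ x).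
    apply: (@geometric_increments_cvg _ _ (Num.sqrt (fine (G x)))) => k.
    have GD : D k x <= fine (G x).
      rewrite -lee_fin fineK//; apply: le_trans (nneseries_lim_ge k.+1 _); last first.
        by move=> n _ _; rewrite lee_fin.
      rewrite big_nat_recr//= leeDr// sume_ge0// => n _.
      by rewrite lee_fin.
    rewrite ler_pdivlMr ?exprn_gt0//.
    have -> : `|s k.+1 x - s k x| * 2 ^+ k = Num.sqrt (D k x).
      rewrite /D (_ : 4 ^+ k = (2 ^+ k) ^+ 2) -?exprMn; last first.
        by rewrite exprAC; congr (_ ^+ _); rewrite expr2; lra.
      by rewrite sqrtr_sqr normrM mulrC ger0_norm// exprn_ge0.
    by rewrite ler_sqrt// fine_ge0.
  have sl : s^~ x @ \oo --> fine (lims x).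
    rewrite /lims.
    have /cvg_ex[l sl] := cs.
    have : (s n x)%:E @[n --> \oo] --> l%:E.
      by apply: cvg_EFin => //; exact: nearW.
    by move=> /cvg_limn_einf_sup[_ ->].
  rewrite (_ : u^~ x = (fun n => s n x ^+ 2)); first by rewrite expr2; exact: cvgM.
  by apply/funext => n; rewrite /s sqr_sqrtr.
Qed.

(* Near-minimisers of the entropy over a decreasing sequence of convex sets
   are Cauchy for the Hellinger distance. *)
Lemma entropy_closure r (G : set (T -> R)) :
  (forall g, G g -> all_exp_moments P g) ->
  (forall e, 0 < e -> exists2 q, entropy_density P (r + e) q &
     forall g, G g -> - e <= \int[P]_x (q x * g x)) ->
  exists2 q, entropy_density P r q & forall g, G g -> 0 <= \int[P]_x (q x * g x).
Proof.
move=> eG hG.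
pose ep n : R := n.+1%:R^-1.
have ep0 n : 0 < ep n by rewrite invr_gt0.
have ep_le m n : (m <= n)%N -> ep n <= ep m.
  by move=> mn; rewrite lef_pV2 ?posrE// ler_nat.
have ep_small (e : R) : 0 < e -> exists N, forall n, (N <= n)%N -> ep n < e.
  by move=> e0; have [N _ hN] := near_infty_natSinv_lt (PosNum e0); exists N.
pose A n : set (T -> R) := [set q | entropy_density P (r + ep n) q /\
  forall g, G g -> - ep n <= \int[P]_x (q x * g x)].
have Asub m n q : (m <= n)%N -> A n q -> A m q.
  move=> mn [h1 h2]; have := ep_le _ _ mn => le; split.
    by apply: entropy_density_weaken h1; lra.
  by move=> g /h2; lra.
pose H q := \int[P]_x xlnx (q x).
(* These infima increase with [n] and stay below [r + 1]; their convergence to the supremum [hs]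
   makes late near-minimisers close to each other. *)
pose h n := inf (H @` A n).
have Ane n : A n !=set0 by have [q q1 q2] := hG _ (ep0 n); exists q.
have Hge q n : A n q -> -1 <= H q.
  move=> [[mq q0 iq q1 ixq _] _].
  rewrite -[-1](Rintegral_probability_cst P); apply: le_Rintegral => //.
    exact: rintegrable_cst.
  by move=> x _; exact: xlnx_ge_N1.
have lbA n : has_lbound (H @` A n) by exists (-1) => _ [q /Hge ? <-].
have infA n : has_inf (H @` A n).
  by split => //; have [q Aq] := Ane n; exists (H q), q.
have h_le n q : A n q -> h n <= H q by move=> Aq; apply: ge_inf => //; exists q.
have h_mono m n : (m <= n)%N -> h m <= h n.
  move=> mn; apply: lb_le_inf; first by case: (infA n).
  by move=> _ [q Aq <-]; apply: h_le; exact: Asub Aq.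
have h_ub n : h n <= r + 1.
  have [q Aq] := Ane n; apply: le_trans (h_le _ _ Aq) _.
  case: Aq => -[_ _ _ _ _ qr] _; apply: le_trans qr _; rewrite lerD2l.
  by rewrite invf_le1// ler1n.
have sup_h : has_sup (range h).
  by split; [exists (h 0%N), 0%N|exists (r + 1) => _ [n _ <-]].
set hs := sup (range h).
have h_hs n : h n <= hs by apply: ub_le_sup; [case: sup_h|exists n].
have /choice[v hv] n : exists q, A n q /\ H q < h n + ep n.
  by have [_ [q Aq <-] ?] := inf_adherent (ep0 n) (infA n); exists q.
(* Chosen so that [4 ^ k * (2 * c k) = 1 / 2 ^ (k + 1)], the bound required by
   [hellinger_cauchy_ae_limit]. *)
pose c k : R := (4 ^+ k)^-1 / (2 ^ k.+1)%:R / 2.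
have c0 k : 0 < c k by rewrite !divr_gt0// invr_gt0 exprn_gt0.
have /choice[N hN] k : exists N, forall n, (N <= n)%N -> hs - h n + 2 * ep n <= c k.
  have c20 : 0 < c k / 4 by rewrite divr_gt0.
  have [_ [n0 _ <-] hn0] := sup_adherent c20 sup_h.
  have [n1 hn1] := ep_small _ c20.
  exists (maxn n0 n1) => n; rewrite geq_max => /andP[/h_mono hn /hn1 en].
  by move: hn0; rewrite -/hs; have := c0 k; lra.
(* The partial sums make [f] nondecreasing and at least as large as both [N k] and [k]. *)
pose f k := (\sum_(j < k.+1) N j + k)%N.
have f_ge k : (N k <= f k)%N by rewrite /f big_ord_recr /=; lia.
have f_mono k : (f k <= f k.+1)%N by rewrite /f [in leqRHS]big_ord_recr /=; lia.
have f_k k : (k <= f k)%N by rewrite /f; lia.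
have gap k : P.-integrable setT
    (EFin \o (fun x => (Num.sqrt (v (f k.+1) x) - Num.sqrt (v (f k) x)) ^+ 2)) /\
  4 ^+ k * \int[P]_x ((Num.sqrt (v (f k.+1) x) - Num.sqrt (v (f k) x)) ^+ 2)
     <= 1 / (2 ^ k.+1)%:R.
  have [A1 H1] := hv (f k); have [A2 H2] := hv (f k.+1).
  have [ed1 g1] := A1; have [ed2 g2] := Asub _ _ _ (f_mono k) A2.
  have [m1 m2 m3] := entropy_density_midpoint ed2 ed1.
  split => //.
  (* The midpoint lies in the earlier, larger set, so its entropy is at least [h (f k)]. The end
     points have entropies below [h (f k) + ep (f k)] and [hs + ep (f k)], so the convexity gap is
     at most [c k]. *)
  have Am : A (f k) (fun x => (v (f k.+1) x + v (f k) x) / 2).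
    split => // g Gg; have eg := eG _ Gg.
    have i1 := entropy_density_integrable ed1 eg.
    have i2 := entropy_density_integrable ed2 eg.
    rewrite (_ : (fun x => _) =
      (fun x => 2^-1 * (v (f k.+1) x * g x + v (f k) x * g x))); last first.
      by apply/funext => x; field.
    rewrite RintegralZl//; last exact: rintegrableD.
    by rewrite RintegralD//; have := g1 _ Gg; have := g2 _ Gg; lra.
  have hm := h_le _ _ Am.
  have := hN k _ (f_ge k); have := h_hs (f k.+1); have := ep_le _ _ (f_mono k).
  move: m3 hm H1 H2; rewrite /H => m3 hm H1 H2 e1 e2 e3.
  have : \int[P]_x ((Num.sqrt (v (f k.+1) x) - Num.sqrt (v (f k) x)) ^+ 2) <= 2 * c k.
    by lra.
  move=> /(ler_wpM2l (exprn_ge0 k (ler0n R 4)))/le_trans; apply.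
  rewrite /c mulrCA [4 ^+ k * _]mulrC !mulrA -!mulrA mulrC.
  by rewrite le_eqVlt; apply/orP; left; apply/eqP; field; rewrite expf_neq0 ?pnatr_eq0// expn_eq0.
have [q [mq q0 vq]] := @hellinger_cauchy_ae_limit (fun k => v (f k))
  (fun k => ed_measurable (proj1 (proj1 (hv (f k)))))
  (fun k => ed_ge0 (proj1 (proj1 (hv (f k)))))
  (fun k => proj1 (gap k)) (fun k => proj2 (gap k)).
have ed k : entropy_density P (r + ep 0%N) (v (f k)).
  by have [] := Asub _ _ _ (leq0n _) (proj1 (hv (f k))).
have ep_near (e : R) : 0 < e -> \forall k \near \oo, ep (f k) <= e.
  move=> /ep_small[M hM]; exists M => // k /= Mk; apply/ltW/hM.
  exact: leq_trans Mk (f_k k).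
have vr (e : R) : 0 < e -> \forall k \near \oo, \int[P]_x xlnx (v (f k) x) <= r + e.
  move=> /ep_near; apply: filterS => k ek.
  by have [[[_ _ _ _ _ +] _] _] := hv (f k); lra.
exists q; first exact: entropy_density_limit ed vr mq q0 vq.
move=> g Gg; apply: (entropy_density_limit_moment ed vr mq q0 vq (eG _ Gg)).
move=> e /ep_near; apply: filterS => k ek.
by have [[_ /(_ _ Gg) h1] _] := hv (f k); apply: le_trans h1; lra.
Qed.

End entropy_closure.

(** * Change of variables for weighted image measures *)

Section weighted_pushforward.
Context d d' (X : measurableType d) (T : measurableType d') (R : realType).
Variables (mu : {measure set X -> \bar R}) (nu : {measure set T -> \bar R}).
Variables (phi : X -> T) (w : X -> R).
Hypothesis mphi : measurable_fun setT phi.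
Hypothesis mw : measurable_fun setT w.
Hypothesis w0 : forall x, 0 <= w x.
Hypothesis nuE : forall A, measurable A ->
  nu A = (\int[mu]_(x in phi @^-1` A) (w x)%:E)%E.

Import HBNNSimple.

Let weighted_nnsfun (h : {nnsfun T >-> R}) :
  (\int[nu]_x (h x)%:E = \int[mu]_x ((h (phi x))%:E * (w x)%:E))%E.
Proof.
transitivity (\sum_(y \in range h) y%:E * nu (h @^-1` [set y]))%E.
  under eq_integral do rewrite fimfunE -fsumEFin//.
  rewrite ge0_integral_fsum//; last 2 first.
  - by move=> y; apply/measurable_EFinP; exact: measurable_funM.
  - by move=> y x _; exact: nnfun_muleindic_ge0.
  apply: eq_fsbigr => y _; rewrite integralZl_indic_nnsfun//.
  by rewrite integral_indic// setIT.
apply/esym.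
transitivity (\int[mu]_x (\sum_(y \in range h)
    (y * \1_(h @^-1` [set y]) (phi x))%:E * (w x)%:E))%E.
  apply: eq_integral => x _; rewrite {1}fimfunE -fsumEFin//.
  by rewrite ge0_mule_fsuml// => y; exact: nnfun_muleindic_ge0.
rewrite ge0_integral_fsum//; last 2 first.
- move=> y; apply: emeasurable_funM; last exact/measurable_EFinP.
  by apply/measurable_EFinP/measurable_funM => //; exact: measurableT_comp.
- by move=> y x _; rewrite mule_ge0// ?lee_fin//; exact: nnfun_muleindic_ge0.
apply: eq_fsbigr => y; rewrite inE => -[t _ <-].
under eq_integral do rewrite EFinM -muleA.
rewrite ge0_integralZl//.
- rewrite nuE; last exact: measurable_sfunP.
  congr (_ * _)%E; rewrite [RHS]integral_mkcond.
  apply: eq_integral => x _; rewrite patchE indicE.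
  have -> : (x \in phi @^-1` (h @^-1` [set h t])) = (phi x \in h @^-1` [set h t]).
    by apply/idP/idP; rewrite !inE.
  by case: ifPn => _; rewrite ?mul1e ?mul0e.
- apply: emeasurable_funM; last exact/measurable_EFinP.
  by apply/measurable_EFinP; exact: measurableT_comp.
- by move=> x _; rewrite mule_ge0// lee_fin.
- by rewrite lee_fin.
Qed.

(** [nu] is the image under [phi] of [mu] weighted by [w]. One formula thus covers densities
    ([phi = id]), laws of random variables ([w = 1]) and conditional laws. *)
Lemma ge0_integral_weighted_pushforward (f : T -> \bar R) :
  measurable_fun setT f -> (forall x, 0 <= f x)%E ->
  (\int[nu]_x f x = \int[mu]_x (f (phi x) * (w x)%:E))%E.
Proof.
move=> mf f0.
pose h := nnsfun_approx measurableT mf.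
have hf x : (h n x)%:E @[n --> \oo] --> f x by exact: cvg_nnsfun_approx.
have hnd x m n : (m <= n)%N -> h m x <= h n x.
  by move=> mn; exact/lefP/nd_nnsfun_approx.
transitivity (limn (fun n => \int[nu]_x (h n x)%:E))%E.
  rewrite -monotone_convergence//.
  - by apply: eq_integral => x _; apply/esym/cvg_lim => //; exact: hf.
  - by move=> n; exact/measurable_EFinP.
  - by move=> n x _; rewrite lee_fin.
  - by move=> x _ m n mn; rewrite lee_fin hnd.
under eq_fun do rewrite weighted_nnsfun.
rewrite -monotone_convergence//.
- apply: eq_integral => x _; apply/cvg_lim => //.
  by apply: cvgeZr => //; exact: hf.
- move=> n; apply: emeasurable_funM; last exact/measurable_EFinP.
  by apply/measurable_EFinP; exact: measurableT_comp.
- by move=> n x _; rewrite mule_ge0// lee_fin.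
- by move=> x _ m n mn; rewrite lee_wpmul2r// lee_fin// hnd.
Qed.

Lemma integrable_weighted_pushforward (g : T -> R) : measurable_fun setT g ->
  nu.-integrable setT (EFin \o g) <->
  mu.-integrable setT (EFin \o (fun x => g (phi x) * w x)).
Proof.
move=> mg.
have mgw : measurable_fun setT (fun x => g (phi x) * w x).
  by apply: measurable_funM => //; exact: measurableT_comp.
have E : (\int[nu]_x `|(g x)%:E| =
          \int[mu]_x `|(g (phi x) * w x)%:E|)%E.
  rewrite ge0_integral_weighted_pushforward//; last first.
    by apply: measurableT_comp => //; exact/measurable_EFinP.
  by apply: eq_integral => x _ /=; rewrite -EFinM normrM (ger0_norm (w0 x)).
split => /integrableP[_ h]; apply/integrableP; split; try exact/measurable_EFinP.
  by rewrite -E.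
by rewrite E.
Qed.

Lemma Rintegral_weighted_pushforward (g : T -> R) :
  nu.-integrable setT (EFin \o g) ->
  \int[nu]_x g x = \int[mu]_x (g (phi x) * w x).
Proof.
move=> ig; have mg : measurable_fun setT g by case/integrableP: ig => /measurable_EFinP.
have ge0 (k : T -> R) : measurable_fun setT k -> (forall x, 0 <= k x) ->
    \int[nu]_x k x = \int[mu]_x (k (phi x) * w x).
  move=> mk k0; rewrite /Rintegral; congr fine.
  rewrite ge0_integral_weighted_pushforward//; first exact/measurable_EFinP.
have mn : measurable_fun setT (fun x => `|g x|) by exact: measurableT_comp.
have inn : nu.-integrable setT (EFin \o (fun x => `|g x|)) by exact: integrable_norm.
have inp : nu.-integrable setT (EFin \o (fun x => g x + `|g x|)).
  exact: (integrableD measurableT ig inn).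
have m2 : measurable_fun setT (fun x => g x + `|g x|) by exact: measurable_funD.
(* Splitting [g] as [(g + |g|) - |g|] reduces the signed case to nonnegative integrands. *)
have -> : \int[nu]_x g x = \int[nu]_x (g x + `|g x|) - \int[nu]_x `|g x|.
  by rewrite -RintegralB//; apply: eq_Rintegral => x _; rewrite addrK.
rewrite !ge0//; last by move=> x; rewrite -lerBlDr sub0r lerNnormlW.
rewrite -RintegralB//.
- by apply: eq_Rintegral => x _; ring.
- exact/(integrable_weighted_pushforward m2).
- exact/(integrable_weighted_pushforward mn).
Qed.

End weighted_pushforward.

Section weighted_law.
Context d d' (X : measurableType d) (T : measurableType d') (R : realType).
Variables (mu : {measure set X -> \bar R}) (phi : X -> T) (w : X -> R).
Variables (mphi : measurable_fun setT phi) (mw : measurable_fun setT w).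
Variables (w0 : forall x, 0 <= w x) (w1 : (\int[mu]_x (w x)%:E = 1)%E).

(** The proofs are arguments so that the measure and probability structures can be attached to the
    term itself. *)
Definition weighted_law of measurable_fun setT phi & measurable_fun setT w &
    (forall x, 0 <= w x) & (\int[mu]_x (w x)%:E = 1)%E :=
  fun A : set T => (\int[mu]_(x in phi @^-1` A) (w x)%:E)%E.

Local Notation law := (weighted_law mphi mw w0 w1).

Let law0 : law set0 = 0%E.
Proof. by rewrite /weighted_law preimage_set0 integral_set0. Qed.

Let law_ge0 A : (0 <= law A)%E.
Proof. by apply: integral_ge0 => x _; rewrite lee_fin. Qed.

Let law_sigma_additive : semi_sigma_additive law.
Proof.
move=> F mF tF mUF; rewrite /weighted_law; apply: cvg_toP.
  apply: ereal_nondecreasing_is_cvgn => m n mn.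
  apply: lee_sum_nneg_natr => // k _ _; apply: integral_ge0 => x _.
  by rewrite lee_fin.
rewrite preimage_bigcup ge0_integral_bigcup//.
- by move=> k; rewrite -[_ @^-1` _]setTI; exact: mphi.
- by apply/measurable_EFinP/measurable_funTS.
- by move=> x _; rewrite lee_fin.
- apply/trivIsetP => i j _ _ ij; rewrite -preimage_setI.
  by move/trivIsetP : tF => -> //; rewrite preimage_set0.
Qed.

HB.instance Definition _ := isMeasure.Build _ _ _ law law0 law_ge0 law_sigma_additive.

Let law_setT : law setT = 1%E.
Proof. by rewrite /weighted_law preimage_setT. Qed.

HB.instance Definition _ := Measure_isProbability.Build _ _ _ law law_setT.

Lemma exists_weighted_law : exists Q : probability T R,
  forall A, Q A = (\int[mu]_(x in phi @^-1` A) (w x)%:E)%E.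
Proof. by exists law. Qed.

End weighted_law.

(** * Independent observations conditioned on a likely event *)

Section iid.
Context d (T : measurableType d) (R : realType) (P : probability T R).
Context dO (Omega : measurableType dO) (Prob : probability Omega R).
Variable Zs : nat -> Omega -> T.
Hypothesis Zs_meas : forall i, measurable_fun setT (Zs i).
Hypothesis Zs_law : forall i A, measurable A -> Prob (Zs i @^-1` A) = P A.
Hypothesis Zs_indep : forall (n : nat) (A : nat -> set T),
  (forall i, measurable (A i)) ->
  Prob (\bigcap_(i in `I_n) (Zs i @^-1` A i)) =
    (\prod_(i < n) Prob (Zs i @^-1` A i))%E.

Let mpre i A : measurable A -> measurable (Zs i @^-1` A).
Proof. by move=> mA; rewrite -[_ @^-1` _]setTI; exact: Zs_meas. Qed.

(** Induction on the number [k] of leading factors that need not be indicators. With the other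
    factors fixed, putting [\1_A] in place of the last general factor gives, as [A] varies, a
    multiple of [P]; a change of variables extends the formula from indicators to [f k]. *)
Lemma integral_iid_prod n k (f : nat -> T -> R) (M : R) :
  (forall i, measurable_fun setT (f i)) -> (forall i x, 0 <= f i x <= M) ->
  (forall i, (k <= i)%N -> exists2 A, measurable A & f i = \1_A) ->
  (\int[Prob]_w (\prod_(i < n) f i (Zs i w))%:E =
   (\prod_(i < n) \int[P]_x f i x)%:E)%E.
Proof.
elim: k f M => [|k IH] f M mf f0M fk.
  have /choice[A hA] i : exists A, measurable A /\ f i = \1_A.
    by have [A mA fA] := fk i (leq0n i); exists A.
  transitivity (\int[Prob]_w (\1_(\bigcap_(i in `I_n) (Zs i @^-1` A i)) w)%:E)%E.
    apply: eq_integral => w _; congr EFin; rewrite indicE.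
    case: (boolP (w \in _)) => [|/negP]; rewrite inE => hw.
      apply: big1 => i _; have [_ ->] := hA i; rewrite indicE mem_set//.
      exact: (hw i (ltn_ord i)).
    have [i ilt nAi] : exists2 i, (i < n)%N & ~ A i (Zs i w).
      apply: contrapT => h; apply: hw => i ilt /=.
      by apply: contrapT => nA; apply: h; exists i.
    rewrite (bigD1 (Ordinal ilt))//=; have [_ ->] := hA i.
    by rewrite indicE memNset// mul0r.
  rewrite integral_indic//; last first.
    by apply: bigcap_measurableType => i _; exact/mpre/(proj1 (hA i)).
  rewrite setIT [LHS]Zs_indep; last by move=> i; case: (hA i).
  rewrite (eq_bigr (fun i : 'I_n => (\int[P]_x f i x)%:E)) ?prodEFin// => i _.
  have [mA ->] := hA i; rewrite Zs_law// EFin_Rintegral.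
    by rewrite integral_indic// setIT.
  exact: integrable_indic.
have f'P A : measurable A -> let f' := fun i => if i == k then \1_A else f i in
    (\int[Prob]_w (\prod_(i < n) f' i (Zs i w))%:E =
     (\prod_(i < n) \int[P]_x f' i x)%:E)%E.
  move=> mA f'; apply: (IH _ (Num.max M 1)) => i.
  - by rewrite /f'; case: eqP.
  - rewrite /f'; case: eqP => _ x.
      by rewrite indicE ler0n le_max; case: (_ \in _); rewrite ?lexx ?ler01 orbT.
    by have /andP[-> h] := f0M i x; rewrite le_max h.
  - rewrite /f'; case: eqP => [_ _|/eqP ik ki]; first by exists A.
    by apply: fk; rewrite ltn_neqAle eq_sym ik.
(* When [n <= k] the factor of index [k] does not occur in the product, and the induction hypothesis
   already concerns the same product. *)
have [nk|kn] := leqP n k.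
  have := f'P setT measurableT; rewrite /=.
  under eq_integral do under eq_bigr => i _ do
    rewrite (ltn_eqF (leq_trans (ltn_ord i) nk)).
  by under eq_bigr => i _ do rewrite (ltn_eqF (leq_trans (ltn_ord i) nk)).
pose i0 : 'I_n := Ordinal kn.
have neq (i : 'I_n) : i != i0 -> ((i : nat) == k) = false.
  by move=> ii0; apply: negbTE; apply: contra ii0 => /eqP ik; apply/eqP/val_inj.
pose w om := \prod_(i < n | i != i0) f i (Zs i om).
pose c := \prod_(i < n | i != i0) \int[P]_x f i x.
have w0 om : 0 <= w om by apply: prodr_ge0 => i _; case/andP: (f0M i (Zs i om)).
have c0 : 0 <= c.
  by apply: prodr_ge0 => i _; apply: Rintegral_ge0 => x _; case/andP: (f0M i x).
have mw : measurable_fun setT w.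
  rewrite /w; under eq_fun do rewrite big_mkcond.
  by apply: measurable_prod => i _; case: (i != i0) => //; exact: measurableT_comp.
have nuE A : measurable A -> mscale (NngNum c0) P A =
    (\int[Prob]_(x in Zs k @^-1` A) (w x)%:E)%E.
  move=> mA; have := f'P A mA; rewrite /= [X in _ = X%:E](bigD1 i0)//= eqxx.
  rewrite [X in _ = (_ * X)%:E](_ : _ = c); last first.
    by apply: eq_bigr => i /neq ->.
  rewrite EFinM EFin_Rintegral; last exact: integrable_indic.
  rewrite integral_indic// setIT /mscale /= [(_ * c%:E)%E]muleC => <-.
  rewrite [RHS]integral_mkcond; apply: eq_integral => om _.
  rewrite (bigD1 i0)//= eqxx [X in _ * X](_ : _ = w om); last first.
    by apply: eq_bigr => i /neq ->.
  rewrite patchE indicE.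
  have -> : (om \in Zs k @^-1` A) = (Zs k om \in A) by apply/idP/idP; rewrite !inE.
  by case: ifPn => _; rewrite ?mul1r ?mul0r.
have fk0 x : 0 <= f k x by case/andP: (f0M k x).
have := @ge0_integral_weighted_pushforward _ _ _ _ _ Prob _ _ _ (Zs_meas k) mw w0 nuE
  (EFin \o f k).
rewrite ge0_integral_mscale//; [|exact/measurable_EFinP|by move=> x _; rewrite /= lee_fin].
rewrite /= -EFin_Rintegral; last first.
  apply: rintegrable_dominated (rintegrable_cst P M) _ => // x.
  by rewrite ger0_norm//; case/andP: (f0M k x).
rewrite -EFinM mulrC => h.
rewrite (bigD1 i0)//= h//; last exact/measurable_EFinP.
by apply: eq_integral => om _; rewrite (bigD1 i0).
Qed.

Lemma iid_integrable i g : P.-integrable setT (EFin \o g) ->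
  Prob.-integrable setT (EFin \o (fun w => g (Zs i w))).
Proof.
move=> ig; have mg := rintegrable_measurable ig.
have PE A : measurable A -> P A = (\int[Prob]_(x in Zs i @^-1` A) 1%:E)%E.
  move=> mA; rewrite integral_cst; last exact: mpre.
  by rewrite mul1e; exact/esym/Zs_law.
have := integrable_weighted_pushforward (w := fun=> 1) (Zs_meas i)
  (@measurable_cst _ _ _ _ _ _) (fun=> ler01) PE mg.
move=> [/(_ ig) + _]; congr (_.-integrable _ (_ \o _)).
by apply/funext => w; rewrite mulr1.
Qed.

(** * The law of a uniformly chosen observation given [E] *)

Section conditioned_empirical_law.
Variables (n : nat) (E : set Omega) (r : R).
Hypothesis n0 : (0 < n)%N.
Hypothesis mE : measurable E.
Hypothesis PE : ((expR (- (n%:R * r)))%:E <= Prob E)%E.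

Let p := fine (Prob E).

Let pE : p%:E = Prob E.
Proof. by rewrite fineK// fin_num_measure. Qed.

Let p_ge : expR (- (n%:R * r)) <= p.
Proof. by rewrite -lee_fin pE. Qed.

Let p0 : 0 < p. Proof. exact: lt_le_trans (expR_gt0 _) p_ge. Qed.

Let wE om : R := p^-1 * \1_E om.

Let mwE : measurable_fun setT wE.
Proof. exact: measurable_funM. Qed.

Let wE0 om : 0 <= wE om.
Proof. by rewrite mulr_ge0// ?invr_ge0 ?ltW// indicE. Qed.

Let wE_le om : wE om <= p^-1.
Proof.
rewrite /wE indicE; case: (_ \in _); rewrite ?mulr1// mulr0 invr_ge0 ltW//.
Qed.

Let wE_integrable : Prob.-integrable setT (EFin \o wE).
Proof.
apply: rintegrable_dominated (rintegrable_cst Prob p^-1) _ => // om.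
by rewrite ger0_norm.
Qed.

Let wE1 : (\int[Prob]_om (wE om)%:E = 1)%E.
Proof.
under eq_integral do rewrite EFinM.
rewrite ge0_integralZl//; last by rewrite lee_fin invr_ge0 ltW.
  rewrite integral_indic// setIT [X in (_ * X)%E](_ : _ = p%:E).
    by rewrite -EFinM mulVf// gt_eqF.
  by rewrite pE.
by apply/measurable_EFinP.
Qed.

Let Rwint (S : Omega -> R) : Prob.-integrable setT (EFin \o S) ->
  Prob.-integrable setT (EFin \o (fun om => S om * wE om)).
Proof.
move=> iS; apply: rintegrable_dominated (rintegrableZ p^-1 (integrable_norm iS)) _.
  by apply: measurable_funM => //; exact: rintegrable_measurable iS.
move=> om; rewrite normrM mulrC ger0_norm//; apply: ler_wpM2r => //.
Qed.

(** The conditional law of [Zs i] given [E] is dominated by [P], whence a Radon-Nikodym density.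
    Changing variables once through [Zs i] and once through this density compares the two
    integrals. *)
Let density i : exists q : T -> R, [/\ measurable_fun setT q, forall x, 0 <= q x &
  forall g, P.-integrable setT (EFin \o g) \/ (exists M, measurable_fun setT g /\ forall x, `|g x| <= M) ->
   P.-integrable setT (EFin \o (fun x => g x * q x)) /\
   \int[P]_x (g x * q x) = \int[Prob]_om (g (Zs i om) * wE om)].
Proof.
have [Q QE] := exists_weighted_law (Zs_meas i) mwE wE0 wE1.
have QP : Q `<< P.
  apply/null_content_dominatesP => A mA PA; rewrite QE null_set_integral//.
  - exact: mpre.
  - by apply: measurable_funTS; exact/measurable_EFinP.
  - by rewrite -PA; exact: Zs_law.
have [f [f0 ffin fint fE]] := radon_nikodym_sigma_finite QP.
have mf : measurable_fun setT f by case/integrableP: fint.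
exists (fine \o f); split.
- exact: measurableT_comp.
- by move=> x; exact: fine_ge0.
- move=> g hg.
  have QE' A : measurable A -> Q A = (\int[P]_(x in id @^-1` A) ((fine \o f) x)%:E)%E.
    by move=> mA; rewrite fE//; apply: eq_integral => x _; rewrite /= fineK.
  have mff : measurable_fun setT (fine \o f) by exact: measurableT_comp.
  have ff0 x : 0 <= (fine \o f) x by exact: fine_ge0.
  have mg : measurable_fun setT g.
    by case: hg => [/rintegrable_measurable//|[M [//]]].
  have QE2 A : measurable A -> Q A = (\int[Prob]_(x in Zs i @^-1` A) (wE x)%:E)%E.
    by move=> _; exact: QE.
  have iQ : Q.-integrable setT (EFin \o g).
    apply/(integrable_weighted_pushforward (Zs_meas i) mwE wE0 QE2 mg)/Rwint.
    case: hg => [ig|[M [_ gM]]]; first exact: iid_integrable.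
    apply: rintegrable_dominated (rintegrable_cst Prob M) _ => //.
    exact: measurableT_comp.
  have mid : measurable_fun setT (@id T) by exact: measurable_id.
  split.
    exact/(integrable_weighted_pushforward mid mff ff0 QE' mg).
  rewrite -(Rintegral_weighted_pushforward (Zs_meas i) mwE wE0 QE2 iQ).
  by rewrite (Rintegral_weighted_pushforward mid mff ff0 QE' iQ).
Qed.

Lemma conditioned_empirical_density : exists q : T -> R,
  [/\ measurable_fun setT q, forall x, 0 <= q x &
  forall g, P.-integrable setT (EFin \o g) \/ (exists M, measurable_fun setT g /\ forall x, `|g x| <= M) ->
   P.-integrable setT (EFin \o (fun x => q x * g x)) /\
   n%:R * \int[P]_x (q x * g x) =
   \int[Prob]_om ((\sum_(i < n) g (Zs i om)) * (p^-1 * \1_E om))].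
Proof.
have /choice[q hq] i := density i.
exists (fun x => n%:R^-1 * \sum_(i < n) q i x); split.
- apply: measurable_funM => //; apply: measurable_sum => i.
  by case: (hq i).
- by move=> x; rewrite mulr_ge0 ?invr_ge0// sumr_ge0// => i _; case: (hq i).
- move=> g hg.
  have ig i : P.-integrable setT (EFin \o (fun x => g x * q i x)).
    by have [_ _ /(_ g hg)[]] := hq i.
  have iw i : Prob.-integrable setT (EFin \o (fun om => g (Zs i om) * wE om)).
    apply/Rwint; case: hg => [ig'|[M [mg gM]]]; first exact: iid_integrable.
    apply: rintegrable_dominated (rintegrable_cst Prob M) _ => //.
    exact: measurableT_comp.
  have Eqg : (fun x => n%:R^-1 * (\sum_(i < n) q i x) * g x) =
      (fun x => n%:R^-1 * \sum_(i < n) (g x * q i x)).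
    apply/funext => x; rewrite -mulrA mulr_suml; congr (_ * _).
    by apply: eq_bigr => i _; rewrite mulrC.
  have isum (m : nat) : P.-integrable setT (EFin \o (fun x => \sum_(i < m) (g x * q i x))) /\
    Prob.-integrable setT (EFin \o (fun om => \sum_(i < m) (g (Zs i om) * wE om))) /\
    \int[P]_x (\sum_(i < m) (g x * q i x)) = \int[Prob]_om (\sum_(i < m) (g (Zs i om) * wE om)).
    elim: m => [|m [IH1 [IH2 IH3]]].
      split; [|split].
      - by under eq_fun do rewrite big_ord0; exact: rintegrable_cst.
      - by under eq_fun do rewrite big_ord0; exact: rintegrable_cst.
      - under eq_Rintegral do rewrite big_ord0.
        under [RHS]eq_Rintegral do rewrite big_ord0.
        by rewrite !Rintegral_probability_cst.
    split; [|split].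
    - by under eq_fun do rewrite big_ord_recr; exact: rintegrableD.
    - by under eq_fun do rewrite big_ord_recr; exact: rintegrableD.
    - under eq_Rintegral do rewrite big_ord_recr.
      under [RHS]eq_Rintegral do rewrite big_ord_recr.
      rewrite RintegralD// RintegralD// IH3; congr (_ + _).
      by have [_ _ /(_ g hg)[]] := hq m.
  have [i1 [_ i3]] := isum n.
  rewrite Eqg; split; first exact: rintegrableZ.
  rewrite RintegralZl// mulrA divff ?pnatr_eq0 -?lt0n// mul1r i3.
  by apply: eq_Rintegral => om _; rewrite mulr_suml.
Qed.

Let wE_mass : \int[Prob]_om wE om = 1.
Proof. by rewrite /Rintegral wE1. Qed.

Section gibbs_variational.
Variable q : T -> R.
Hypothesis hq : forall g, P.-integrable setT (EFin \o g) \/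
  (exists M, measurable_fun setT g /\ forall x, `|g x| <= M) ->
   P.-integrable setT (EFin \o (fun x => q x * g x)) /\
   n%:R * \int[P]_x (q x * g x) =
   \int[Prob]_om ((\sum_(i < n) g (Zs i om)) * (p^-1 * \1_E om)).

(** A Donsker-Varadhan inequality: conditioning on [E] has entropy [- ln p <= n r] relative to
    [Prob]. It is tested on the sum of the [h (Zs i)], whose exponential moment is [L ^ n] by
    independence. *)
Lemma conditioned_empirical_gibbs (h : T -> R) (M : R) :
  measurable_fun setT h -> (forall x, `|h x| <= M) ->
  \int[P]_x (q x * h x) <= ln (\int[P]_x expR (h x)) + r.
Proof.
move=> mh hM.
have nR0 : 0 < n%:R :> R by rewrite ltr0n.
have eM x : expR (h x) <= expR M by rewrite ler_expR (le_trans (ler_norm _)).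
have ie : P.-integrable setT (EFin \o (fun x => expR (h x))).
  apply: rintegrable_dominated (rintegrable_cst P (expR M)) _ => [|x].
    exact: measurableT_comp.
  by rewrite ger0_norm ?expR_ge0.
set L := \int[P]_x expR (h x).
have L0 : 0 < L.
  apply: lt_le_trans (expR_gt0 (- M)) _.
  rewrite -[leLHS](Rintegral_probability_cst P); apply: le_Rintegral => //.
    exact: rintegrable_cst.
  by move=> x _; rewrite ler_expR; have := hM x; rewrite ler_norml => /andP[].
pose S om := \sum_(i < n) h (Zs i om).
have mS : measurable_fun setT S by apply: measurable_sum => i; exact: measurableT_comp.
have SM om : `|S om| <= n%:R * M.
  apply: le_trans (ler_norm_sum _ _ _) _.
  apply: (@le_trans _ _ (\sum_(i < n) M)); first by apply: ler_sum => i _; exact: hM.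
  by rewrite sumr_const card_ord mulr_natl.
have iS : Prob.-integrable setT (EFin \o S).
  exact: rintegrable_dominated (rintegrable_cst Prob (n%:R * M)) _.
have ieS : Prob.-integrable setT (EFin \o (fun om => expR (S om))).
  apply: rintegrable_dominated (rintegrable_cst Prob (expR (n%:R * M))) _ => [|om].
    exact: measurableT_comp.
  by rewrite ger0_norm ?expR_ge0// ler_expR (le_trans (ler_norm _)).
have ES : \int[Prob]_om expR (S om) = L ^+ n.
  pose f i : T -> R := if (i < n)%N then fun x => expR (h x) else \1_setT.
  have : (\int[Prob]_w (\prod_(i < n) f i (Zs i w))%:E =
   (\prod_(i < n) \int[P]_x f i x)%:E)%E.
    apply: (@integral_iid_prod n n f (Num.max (expR M) 1)).
    - by move=> i; rewrite /f; case: ifP => _; [exact: measurableT_comp|].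
    - move=> i x; rewrite /f; case: ifP => _; first by rewrite expR_ge0 le_max eM.
      by rewrite indicT ler01 le_max lexx orbT.
    - move=> i ni; exists setT => //.
      by rewrite /f ltnNge ni.
  under eq_integral do under eq_bigr do rewrite /f ltn_ord.
  under eq_bigr do rewrite /f ltn_ord.
  rewrite prodr_const card_ord => h1; rewrite /Rintegral.
  rewrite (_ : (fun om => (expR (S om))%:E) =
    (fun w => (\prod_(i < n) expR (h (Zs i w)))%:E)) ?h1//.
  by apply/funext => om; rewrite expR_sum.
(* This normalises [expR (S - c) / p] to integral one, so integrating [1 + (S - c) <= expR (S - c)]
   over [E] bounds the conditional mean of [S] by [c]. *)
pose c := n%:R * ln L - ln p.
have ec : expR (- c) * p^-1 * L ^+ n = 1.
  rewrite /c opprB expRB lnK// expRM_natl lnK//.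
  by field; rewrite expf_neq0 ?gt_eqF.
have le om : (1 - c) * wE om + S om * wE om <= expR (- c) * p^-1 * expR (S om).
  rewrite -mulrDl; apply: (@le_trans _ _ (expR (S om - c) * wE om)).
    by apply: ler_wpM2r => //; have := expR_ge1Dx (S om - c); lra.
  have -> : expR (- c) * p^-1 * expR (S om) = expR (S om - c) * p^-1.
    by rewrite expRD; ring.
  by apply: ler_wpM2l => //; exact: expR_ge0.
have iSw := Rwint iS.
have := le_Rintegral measurableT (rintegrableD (rintegrableZ (1 - c) wE_integrable) iSw)
  (rintegrableZ (expR (- c) * p^-1) ieS) (fun om _ => le om).
rewrite RintegralD//; last exact: rintegrableZ.
rewrite RintegralZl// wE_mass RintegralZl// ES ec.
have [_ <-] := hq (or_intror (ex_intro _ M (conj mh hM))).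
rewrite mulr1 => h1.
have lnp : - (n%:R * r) <= ln p by rewrite -ler_expR lnK.
rewrite -(ler_pM2l nR0) mulrDr.
by apply: (@le_trans _ _ c); [lra|rewrite /c; lra].
Qed.

End gibbs_variational.

(* Csiszar's argument: the law of a uniformly chosen observation, conditioned
   on the event, satisfies in the mean every linear constraint valid on it. *)
Lemma conditioned_entropy_density : exists2 q : T -> R, entropy_density P r q &
  forall g c, all_exp_moments P g ->
    (forall om, E om -> n%:R * c <= \sum_(i < n) g (Zs i om)) ->
    c <= \int[P]_x (q x * g x).
Proof.
have nR0 : 0 < n%:R :> R by rewrite ltr0n.
have [q [mq q0 hq]] := conditioned_empirical_density.
have [iq1 mass1] := hq (fun=> 1) (or_introl (rintegrable_cst P 1)).
have E1 : (fun x => q x * 1) = q by apply/funext => x; rewrite mulr1.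
rewrite E1 in iq1 mass1.
have q1 : \int[P]_x q x = 1.
  apply: (mulfI (lt0r_neq0 nR0)); rewrite mass1 RintegralZl// -/wE.
  by rewrite wE_mass sumr_const card_ord.
exists q; last first.
  move=> g c eg Eg.
  have ig : P.-integrable setT (EFin \o g).
    case: eg => mg /(_ 1 ltr01) ieg.
    apply: rintegrable_dominated ieg _ => // x.
    by rewrite mul1r; have := expR_ge1Dx `|g x|; lra.
  have [iqg qg] := hq g (or_introl ig).
  rewrite -(ler_pM2l nR0) qg.
  have iSg : Prob.-integrable setT (EFin \o (fun om => \sum_(i < n) g (Zs i om))).
    elim: (n) => [|m IH].
      by under eq_fun do rewrite big_ord0; exact: rintegrable_cst.
    under eq_fun do rewrite big_ord_recr.
    by apply: rintegrableD => //; exact: iid_integrable.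
  rewrite (_ : n%:R * c = \int[Prob]_om (n%:R * c * wE om)); last first.
    by rewrite RintegralZl// wE_mass mulr1.
  apply: le_Rintegral => //; first exact: rintegrableZ.
    exact: Rwint.
  move=> om _; rewrite -/(wE om) /wE indicE.
  case: (boolP (om \in E)); rewrite ?mulr0// inE => Eom.
  apply: ler_wpM2r; [by rewrite mulr1 invr_ge0 ltW|exact: Eg].
(* The optimal test function [ln q] may be unbounded, hence the clipping of [q] to the interval from
   [ep k] to [1 / ep k]; the offset in [k.+2] keeps [ep k < 1]. *)
pose ep k : R := k.+2%:R^-1.
have ep0 k : 0 < ep k by rewrite invr_gt0.
have ep1 k : ep k < 1 by rewrite invf_lt1// ltr1n.
have epV1 k : 1 < (ep k)^-1 by rewrite invf_gt1.
pose clip k x := Num.min (Num.max (q x) (ep k)) (ep k)^-1.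
have clip_ge k x : ep k <= clip k x.
  by rewrite le_min le_max lexx orbT /= (le_trans (ltW (ep1 k)))// ltW.
have clip_le k x : clip k x <= (ep k)^-1 by rewrite ge_min lexx orbT.
have clip0 k x : 0 < clip k x by exact: lt_le_trans (clip_ge k x).
have clip_q k x : clip k x <= q x + ep k.
  rewrite ge_min; apply/orP; left; rewrite ge_max lerDl lerDr q0 andbT.
  exact: ltW.
have mclip k : measurable_fun setT (clip k).
  by apply: measurable_minr => //; exact: measurable_maxr.
pose h k x := ln (clip k x).
have mh k : measurable_fun setT (h k) by exact: measurableT_comp.
have hM k x : `|h k x| <= - ln (ep k).
  rewrite ler_norml opprK; apply/andP; split; first by rewrite ler_ln ?posrE.
  by rewrite -lnV ?posrE// ler_ln ?posrE ?invr_gt0.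
have iqh k := (hq (h k) (or_intror (ex_intro _ _ (conj (mh k) (hM k))))).1.
have qh_le k : \int[P]_x (q x * h k x) <= r + ep k.
  apply: le_trans (conditioned_empirical_gibbs hq (mh k) (hM k)) _.
  rewrite addrC lerD2l.
  rewrite (_ : (fun x => expR (h k x)) = clip k); last first.
    by apply/funext => x; rewrite lnK ?posrE.
  have ic : P.-integrable setT (EFin \o clip k).
    apply: rintegrable_dominated (rintegrable_cst P (ep k)^-1) _ => // x.
    by rewrite ger0_norm// ltW.
  have l1 : \int[P]_x clip k x <= 1 + ep k.
    rewrite -q1 -[ep k](Rintegral_probability_cst P) -RintegralD//; last exact: rintegrable_cst.
    by apply: le_Rintegral => //; apply: rintegrableD => //; exact: rintegrable_cst.
  have l0 : 0 < \int[P]_x clip k x.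
    apply: lt_le_trans (ep0 k) _.
    rewrite -[leLHS](Rintegral_probability_cst P).
    by apply: le_Rintegral => //; exact: rintegrable_cst.
  have lN1 : -1 < \int[P]_x clip k x - 1 by lra.
  by have := le_ln1Dx lN1; rewrite addrC subrK; lra.
(* The lower bound that Fatou requires: where [q <= 1] clipping does not decrease [q], and where
   [q > 1] the logarithm is nonnegative. *)
have qh_ge k x : -1 <= q x * h k x.
  have [qx1|qx1] := leP (q x) 1.
    have [->|qx0] := eqVneq (q x) 0; first by rewrite mul0r; lra.
    have {}qx0 : 0 < q x by rewrite lt_neqAle eq_sym qx0 q0.
    apply: le_trans (xlnx_ge_N1 (q0 x)) _; apply: ler_wpM2l => //.
    rewrite ler_ln ?posrE// le_min le_max lexx /=.
    exact: le_trans (ltW (epV1 k)).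
  apply: (@le_trans _ _ 0); first lra.
  rewrite mulr_ge0// ln_ge0// le_min le_max (ltW qx1) /=.
  exact: ltW.
have [] := @rfatou _ _ _ P (fun k x => q x * h k x + 1) (fun x => xlnx (q x) + 1) (r + 1).
- by move=> k; apply: rintegrableD => //; exact: rintegrable_cst.
- by move=> k x; have := qh_ge k x; lra.
- by apply: measurable_funD => //; exact: measurable_fun_xlnx.
- by move=> x; have := xlnx_ge_N1 (q0 x); lra.
- apply: aeW => x; apply: cvgD; last exact: cvg_cst.
  have [qx0|qx0] := eqVneq (q x) 0.
    by rewrite /xlnx qx0; under eq_fun do rewrite mul0r; rewrite mul0r; exact: cvg_cst.
  have {}qx0 : 0 < q x by rewrite lt_neqAle eq_sym qx0 q0.
  apply: cvg_near_cst.
  have m0 : 0 < Num.min (q x) (q x)^-1 by rewrite lt_min qx0 invr_gt0.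
  have [N _ hN] := near_infty_natSinv_lt (PosNum m0).
  exists N => // k /= Nk.
  have : ep k < Num.min (q x) (q x)^-1.
    by have := hN k.+1 (leq_trans Nk (leqnSn _)).
  rewrite lt_min => /andP[e1 e2].
  rewrite /h /clip max_l ?(ltW e1)// min_l//.
  by rewrite -[leLHS]invrK lef_pV2 ?posrE ?invr_gt0// ltW.
- move=> e e0; have [N _ hN] := near_infty_natSinv_lt (PosNum e0).
  exists N => // k /= Nk; rewrite RintegralD//; last exact: rintegrable_cst.
  rewrite Rintegral_probability_cst.
  have := qh_le k; have : ep k < e by have := hN k.+1 (leq_trans Nk (leqnSn _)).
  lra.
- move=> iG.
  have ixq : P.-integrable setT (EFin \o (fun x => xlnx (q x))).
    have := rintegrableB iG (rintegrable_cst P 1).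
    by congr (_.-integrable _ (_ \o _)); apply/funext => x; rewrite addrK.
  rewrite RintegralD//; last exact: rintegrable_cst.
  by rewrite Rintegral_probability_cst => ?; split => //; lra.
Qed.

End conditioned_empirical_law.

End iid.

(** * Compact parameter sets and local oscillation *)

Lemma within_continuous_local (R : realType) (Th : topologicalType) (B : set Th)
    (f : Th -> R) (th : Th) : {within B, continuous f} -> B th ->
  forall e : R, 0 < e -> \forall th' \near th, B th' -> `|f th' - f th| < e.
Proof.
move=> cf Bth e e0.
have /cvgrPdist_lt/(_ _ e0) h := cf th.
have h' : nbhs th (fun t => B t -> `|f th - f t| < e).
  change (within B (nbhs th) [set t | `|f th - f t| < e]).
  by rewrite nbhs_subspace_in.
by apply: filterS h' => t ht Bt; rewrite distrC; exact: ht.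
Qed.

(** The near-covering form of compactness, applied to the filter of finite lists of centres directed
    by inclusion. *)
Lemma compact_finite_cover (Th : topologicalType) (C : set Th) (U : Th -> set Th) :
  compact C -> (forall th, C th -> nbhs th (U th)) ->
  exists ts : seq Th, (forall t, t \in ts -> C t) /\
    forall th, C th -> exists2 t, t \in ts & U t th.
Proof.
move=> /compact_near_coveringP cC CU.
pose inC (ts : seq Th) := forall t, t \in ts -> C t.
pose F := filter_from inC (fun ts0 => [set ts : seq Th | {subset ts0 <= ts} /\ inC ts]).
have FF : Filter F.
  apply: filter_from_filter; first by exists [::].
  move=> s1 s2 C1 C2; exists (s1 ++ s2).
    by move=> t; rewrite mem_cat => /orP[/C1|/C2].
  move=> ts [sub Cts]; split; split => // t ht; apply: sub; rewrite mem_cat ht//.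
  by rewrite orbT.
suff /(cC _ F (fun ts th => exists2 t, t \in ts & U t th) FF)[ts Cts hts] :
    forall x, C x -> \forall x' \near x & i \near F, exists2 t, t \in i & U t x'.
  by exists ts; split => //; exact: (hts ts (conj (fun t ht => ht) Cts)).
move=> x Cx; exists (U x, [set ts : seq Th | {subset [:: x] <= ts} /\ inC ts]) => /=.
  split; first exact: CU.
  by exists [:: x] => // t; rewrite inE => /eqP ->.
by move=> [x' ts] /= [Ux' [sub _]]; exists x => //; apply: sub; rewrite inE.
Qed.

(** The sequence enumerates finite nets of mesh [1 / (m + 1)] through [pickle]. It will turn the
    oscillation into a countable, hence measurable, supremum. *)
Lemma compact_dense_seq (R : realType) (Th : pseudoMetricType R) (B : set Th) :
  compact B -> B !=set0 -> exists dn : nat -> Th, (forall k, B (dn k)) /\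
    forall th U, B th -> nbhs th U -> exists k, U (dn k).
Proof.
move=> cB [th0 Bth0].
have /choice[net hnet] (m : nat) : exists ts : seq Th, (forall t, t \in ts -> B t) /\
    forall th, B th -> exists2 t, t \in ts & ball t m.+1%:R^-1 th.
  by apply: compact_finite_cover => // th _; apply: nbhsx_ballx; rewrite invr_gt0.
pose dn k := if unpickle k is Some (m, j) then
  (if (j < size (net m))%N then nth th0 (net m) j else th0) else th0.
exists dn; split.
- move=> k; rewrite /dn; case: unpickle => [[m j]|//]; case: ifPn => // jm.
  by have [+ _] := hnet m; apply; exact: mem_nth.
- move=> th U Bth /nbhs_ballP[e /= e0 eU].
  have [N _ /(_ N (leqnn N)) hN] := near_infty_natSinv_lt (PosNum e0).
  have [t tin bt] := (hnet N).2 th Bth.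
  exists (pickle (N, index t (net N))); rewrite /dn pickleK index_mem tin nth_index//.
  by apply: eU; apply: ball_sym; apply: le_ball bt; exact: ltW.
Qed.

Section oscillation.
Context d (T : measurableType d) (R : realType) (P : probability T R).
Variables (Th : pseudoMetricType R) (B : set Th) (l : Th -> T -> R) (e : T -> R).
Hypothesis cB : compact B.
Hypothesis ml : forall th, B th -> measurable_fun setT (l th).
Hypothesis cl : forall z, {within B, continuous (fun th => l th z)}.
Hypothesis me : all_exp_moments P e.
Hypothesis le : forall th th' z, B th -> B th' -> `|l th z - l th' z| <= e z.

Let e0 th z : B th -> 0 <= e z.
Proof. by move=> Bth; apply: le_trans (le z Bth Bth); exact: normr_ge0. Qed.

(** On balls shrinking to [th] the oscillation tends to [0] pointwise and is dominated by [e], so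
    its exponential moment tends to [1] and is eventually at most [2]. The supremum runs over a
    dense sequence; continuity extends its bound to every parameter of [B] interior to the ball. *)
Lemma local_oscillation th a : B th -> 0 < a -> exists o : T -> R, exists U : set Th,
  [/\ nbhs th U, measurable_fun setT o, forall z, 0 <= o z <= e z,
      \int[P]_z expR (a * o z) <= 2 &
      forall th' z, B th' -> U th' -> `|l th' z - l th z| <= o z].
Proof.
move=> Bth a0.
have [|dn [Bdn ddn]] := compact_dense_seq cB; first by exists th.
pose u m k z : R := if `[< ball th m.+1%:R^-1 (dn k) >] then `|l (dn k) z - l th z| else 0.
have u0 m k z : 0 <= u m k z by rewrite /u; case: ifP.
have ue m k z : u m k z <= e z.
  by rewrite /u; case: ifP => _; [exact: le|exact: e0 Bth].
have ubu m z : has_ubound (range (u m ^~ z)) by exists (e z) => _ [k _ <-].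
pose o m z := sups (u m ^~ z) 0%N.
have mo m : measurable_fun setT (o m).
  apply: measurable_fun_sups => // k.
  rewrite /u; case: asboolP => _ //.
  apply: measurableT_comp => //; apply: measurable_funB; exact: ml.
have oE m z : o m z = sup (range (u m ^~ z)).
  rewrite /o /sups /= /sdrop; congr sup; apply/seteqP.
  by split => _ [k _ <-]; exists k.
have uo m k z : u m k z <= o m z by rewrite oE; apply: ub_le_sup => //; exists k.
have o0 m z : 0 <= o m z by exact: le_trans (u0 m 0%N z) (uo _ _ _).
have oe m z : o m z <= e z.
  by rewrite oE; apply: ge_sup => [|_ [k _ <-]//]; exists (u m 0%N z), 0%N.
have o_small z (eta : R) : 0 < eta -> \forall m \near \oo, o m z <= eta.
  move=> eta0; have := within_continuous_local (cl (z := z)) Bth eta0.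
  move=> /nbhs_ballP[dl /= dl0 hdl].
  have [N _ hN] := near_infty_natSinv_lt (PosNum dl0).
  exists N => // m Nm; rewrite oE; apply: ge_sup; first by exists (u m 0%N z), 0%N.
  move=> _ [k _ <-]; rewrite /u; case: asboolP => [b|_]; last exact: ltW.
  apply/ltW/hdl => //; apply: le_ball b; apply/ltW; exact: hN.
have ieo m : P.-integrable setT (EFin \o (fun z => expR (a * o m z))).
  apply: all_exp_moments_integrable; apply: all_exp_moments_dominated me _ => // z.
  by rewrite ger0_norm.
have iee := all_exp_moments_integrable a me.
have [m om2] : exists m, \int[P]_z expR (a * o m z) <= 2.
  apply: contrapT => hn.
  have hn' m : 2 < \int[P]_z expR (a * o m z).
    by rewrite ltNge; apply/negP => ?; apply: hn; exists m.
  (* Dominated convergence, as Fatou for the gap below the envelope: moments all above [2]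
     contradict the limit [1]. *)
  have [] := @rfatou _ _ _ P (fun m z => expR (a * e z) - expR (a * o m z))
    (fun z => expR (a * e z) - 1) (\int[P]_z expR (a * e z) - 2).
  - by move=> m; exact: rintegrableB.
  - by move=> m z; rewrite subr_ge0 ler_expR ler_wpM2l// ltW.
  - apply: measurable_funB => //; exact: rintegrable_measurable iee.
  - by move=> z; rewrite subr_ge0 -expR0 ler_expR mulr_ge0 ?(e0 z Bth)// ltW.
  - apply: aeW => z; apply: cvgB; first exact: cvg_cst.
    rewrite -expR0 -(mulr0 a); apply: continuous_cvg; first exact: continuous_expR.
    apply: cvgM; first exact: cvg_cst.
    apply/cvgrPdist_le => eta eta0; apply: filterS (o_small z eta eta0) => m.
    by rewrite sub0r normrN ger0_norm.
  - move=> eta eta0; apply: nearW => m; rewrite RintegralB//.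
    by have := hn' m; lra.
  - move=> _; rewrite RintegralB//; last exact: rintegrable_cst.
    by rewrite Rintegral_probability_cst; lra.
exists (o m), (ball th m.+1%:R^-1)^°; split => //.
- by apply: nbhs_interior; exact: (nbhsx_ballx th m.+1%:R^-1).
- by move=> z; rewrite o0 oe.
- move=> th' z Bth' bth'; apply/ler_addgt0Pr => eta eta0.
  have h1 := within_continuous_local (cl (z := z)) Bth' eta0.
  have h2 : nbhs th' (ball th m.+1%:R^-1) by exact: bth'.
  have [k [hk1 hk2]] := ddn _ _ Bth' (filterI h1 h2).
  have := uo m k z; rewrite /u asboolT// => h3.
  have h4 := hk1 (Bdn k).
  rewrite (_ : l th' z - l th z = (l (dn k) z - l th z) - (l (dn k) z - l th' z)); last by ring.
  by apply: le_trans (ler_normB _ _) _; lra.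
Qed.

Lemma oscillation_cover (C : set Th) a : compact C -> C `<=` B -> 0 < a ->
  exists (o : Th -> T -> R) (ts : seq Th), (forall t, t \in ts -> C t) /\
    (forall t, C t -> [/\ measurable_fun setT (o t), forall z, 0 <= o t z <= e z &
       \int[P]_z expR (a * o t z) <= 2]) /\
    forall th, C th -> exists2 t, t \in ts & forall z, `|l th z - l t z| <= o t z.
Proof.
move=> cC CB a0.
have /choice[p hp] th : exists p : (T -> R) * set Th, C th ->
  [/\ nbhs th p.2, measurable_fun setT p.1, forall z, 0 <= p.1 z <= e z,
      \int[P]_z expR (a * p.1 z) <= 2 &
      forall th' z, B th' -> p.2 th' -> `|l th' z - l th z| <= p.1 z].
  have [Cth|?] := pselect (C th); last by exists (fun=> 0, setT).
  by have [os [U h]] := local_oscillation (CB _ Cth) a0; exists (os, U).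
have [|ts [tC cov]] := @compact_finite_cover Th C (fun th => (p th).2) cC.
  by move=> th /hp[].
exists (fun t => (p t).1), ts; split => //; split; first by move=> t /hp[].
move=> th Cth; have [t tin pt] := cov _ Cth; exists t => // z.
by have [_ _ _ _ h] := hp _ (tC _ tin); apply: h => //; exact: CB.
Qed.

End oscillation.

(** * Events whose probability is bounded below exponentially *)

Lemma limn_esup_gt_frequently (R : realType) (u : nat -> \bar R) (x : \bar R) (N : nat) :
  (x < limn_esup u)%E -> exists2 n, (N <= n)%N & (x < u n)%E.
Proof.
move=> h.
have /ereal_sup_gt[_ [n /= Nn <-] xu] :
    (x < ereal_sup (u @` [set n | (N <= n)%N]))%E.
  apply: lt_le_trans h _; apply: ereal_inf_lbound.
  by exists [set n | (N <= n)%N] => //; exists N.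
by exists n.
Qed.

Lemma log_rate_gt (R : realType) dO (Omega : measurableType dO)
    (Prob : probability Omega R) (E : nat -> set Omega) (n : nat) (r : R) :
  (0 < n)%N -> measurable (E n) -> ((- r)%:E < log_rate Prob E n)%E ->
  ((expR (- (n%:R * r)))%:E < Prob (E n))%E.
Proof.
move=> n0 mE; rewrite /log_rate.
have nR0 : 0 < n%:R :> R by rewrite ltr0n.
have fE : Prob (E n) \is a fin_num by exact: fin_num_measure.
rewrite -(fineK fE); set p := fine _.
have [p0|p0] := leP p 0.
  by rewrite le0_lneNy// gt0_muleNy// lte_fin invr_gt0.
rewrite lne_EFin// -EFinM !lte_fin -[_ * ln p]mulrC ltr_pdivlMr// => h.
by rewrite -[p in _ < p](@lnK R p) ?posrE// ltr_expR; lra.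
Qed.

(** Only infinitely many [n] are asked for, which is all that a lower bound on a limsup provides. *)
Definition exp_likely (R : realType) dO (Omega : measurableType dO)
    (Prob : probability Omega R) (E : nat -> set Omega) (r : R) : Prop :=
  forall N, exists2 n, (N <= n)%N & ((expR (- (n%:R * r)))%:E < Prob (E n))%E.

(** The strict gap [r' < r] is kept in reserve to absorb the cardinality of finite covers. *)
Lemma limn_esup_exp_likely (R : realType) dO (Omega : measurableType dO)
    (Prob : probability Omega R) (E : nat -> set Omega) (r : R) :
  (forall n, measurable (E n)) -> ((- r)%:E < limn_esup (log_rate Prob E))%E ->
  exists2 r', r' < r & exp_likely Prob E r'.
Proof.
move=> mE hr.
have [r' rr' hr'] : exists2 r', r' < r & ((- r')%:E < limn_esup (log_rate Prob E))%E.
  move: hr; case: (limn_esup _) => [x| |//].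
  - rewrite lte_fin => hx; exists ((r - x) / 2); first by lra.
    by rewrite lte_fin; lra.
  - by move=> _; exists (r - 1); [lra|exact: ltry].
exists r' => // N.
have [n] := limn_esup_gt_frequently (maxn 1 N) hr'; rewrite geq_max => /andP[n1 nN] h.
by exists n => //; exact: log_rate_gt.
Qed.

Lemma exp_dominates_nat (R : realType) (M : nat) (c : R) : 0 < c ->
  exists N : nat, forall n, (N <= n)%N -> M%:R <= expR (n%:R * c).
Proof.
move=> c0; exists (Num.truncn (M%:R / c)).+1 => n hn.
have : M%:R / c <= n%:R.
  by apply/ltW; apply: lt_le_trans (truncnS_gt _) _; rewrite ler_nat.
by rewrite ler_pdivrMr// => h1; have := expR_ge1Dx (n%:R * c); lra.
Qed.

Lemma probability_finite_cover_le (R : realType) dO (Omega : measurableType dO)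
    (Prob : probability Omega R) (I : eqType) (s : seq I) (E : set Omega)
    (F : I -> set Omega) (c : R) :
  measurable E -> (forall i, i \in s -> measurable (F i)) ->
  (forall w, E w -> exists2 i, i \in s & F i w) ->
  (forall i, i \in s -> (Prob (F i) <= c%:E)%E) ->
  (Prob E <= ((size s)%:R * c)%:E)%E.
Proof.
elim: s E => [|j s IH] E mE mF EF Fc.
  rewrite (_ : E = set0) ?measure0 ?mul0r//.
  by apply/seteqP; split => // w /EF[].
have mFj : measurable (F j) by apply: mF; rewrite mem_head.
apply: (@le_trans _ _ (Prob (F j `|` (E `\` F j)))%E).
  apply: le_measure; rewrite ?inE//.
    by apply: measurableU => //; exact: measurableD.
  by move=> w Ew; have [?|?] := pselect (F j w); [left|right].
apply: le_trans (measureU2 _ mFj (measurableD mE mFj)) _.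
rewrite (_ : (size (j :: s))%:R * c = c + (size s)%:R * c); last first.
  by rewrite /= -natr1; ring.
rewrite EFinD leeD//.
  by apply: Fc; rewrite mem_head.
apply: IH => //; first exact: measurableD.
- by move=> i si; apply: mF; rewrite in_cons si orbT.
- move=> w [/EF[i]]; rewrite in_cons => /orP[/eqP ->//|si] Fi _.
  by exists i.
- by move=> i si; apply: Fc; rewrite in_cons si orbT.
Qed.

(** Otherwise every [F i] is eventually below [exp (- n r')], and the union bound contradicts the
    lower bound on [E] once [exp (n (r' - r))] reaches the size of [s]. *)
Lemma exp_likely_finite_union (R : realType) dO (Omega : measurableType dO)
    (Prob : probability Omega R) (I : eqType) (s : seq I) (E : nat -> set Omega)
    (F : I -> nat -> set Omega) (r r' : R) :
  (forall n, measurable (E n)) -> (forall i n, i \in s -> measurable (F i n)) ->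
  (forall n w, E n w -> exists2 i, i \in s & F i n w) ->
  r < r' -> exp_likely Prob E r -> exists2 i, i \in s & exp_likely Prob (F i) r'.
Proof.
move=> mE mF EF rr' hE; apply: contrapT => hno.
have /choice[N hN] i : exists N, i \in s -> forall n, (N <= n)%N ->
    (Prob (F i n) <= (expR (- (n%:R * r')))%:E)%E.
  have [si|?] := boolP (i \in s); last by exists 0%N.
  have /existsNP[N hN] : ~ exp_likely Prob (F i) r' by move=> h; apply: hno; exists i.
  exists N => _ n Nn; rewrite leNgt; apply/negP => h; apply: hN; by exists n.
have rr0 : 0 < r' - r by lra.
have [M hM] := exp_dominates_nat (size s) rr0.
have [n] := hE (maxn M (\max_(i <- s) N i)); rewrite geq_max => /andP[nM nN].
have Nn i : i \in s -> (N i <= n)%N.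
  by move=> si; apply: leq_trans nN; exact: leq_bigmax_seq.
have := @probability_finite_cover_le _ _ _ Prob _ s (E n) (F^~ n) (expR (- (n%:R * r')))
  (mE n) (fun i => mF i n) (EF n) (fun i si => hN i si n (Nn i si)).
move=> h1 h2; have := lt_le_trans h2 h1; rewrite lte_fin ltNge => /negP; apply.
apply: (@le_trans _ _ (expR (n%:R * (r' - r)) * expR (- (n%:R * r')))).
  by apply: ler_wpM2r; [exact: expR_ge0|exact: hM].
by rewrite -expRD ler_expR; lra.
Qed.

(** * Nested pairs of models and near-optimal parameters *)

Section model_pair.
Context d (T : measurableType d) (R : realType) (P : probability T R).
Variables (Th : pseudoMetricType R) (A B : set Th) (l : Th -> T -> R) (e : T -> R).
Hypothesis cA : compact A.
Hypothesis cB : compact B.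
Hypothesis AB : A `<=` B.
Hypothesis ml : forall th, B th -> measurable_fun setT (l th).
Hypothesis cl : forall z, {within B, continuous (fun th => l th z)}.
Hypothesis me : all_exp_moments P e.
Hypothesis le : forall th th' z, B th -> B th' -> `|l th z - l th' z| <= e z.

Let em c : all_exp_moments P (fun z => c * e z).
Proof.
case: me => m0 h; have [->|c0] := eqVneq c 0.
  split; first by apply: measurable_funM.
  move=> a a0; under eq_fun do rewrite mul0r normr0 mulr0.
  exact: rintegrable_cst.
split; first by apply: measurable_funM.
move=> a a0; under eq_fun do rewrite normrM mulrA.
by apply: h; rewrite mulr_gt0// normr_gt0.
Qed.

Let ediff th th' : B th -> B th' -> all_exp_moments P (fun z => l th z - l th' z).
Proof.
move=> Bth Bth'; apply: all_exp_moments_dominated me _ => [|z]; last exact: le.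
by apply: measurable_funB; exact: ml.
Qed.

(** Holding [th] fixed makes the constraints linear in [q], the form that [entropy_closure]
    accepts. *)
Definition near_optimal (r eps : R) (th : Th) (q : T -> R) : Prop :=
  entropy_density P r q /\
  forall th', B th' -> - eps <= \int[P]_x (q x * (l th x - l th' x)).

(** The exponent is tuned to the moment bound [2]: the entropy inequality gives
    [eps / (|r| + 1) * (r + 2 - 1)]. *)
Let moment_small (r eps : R) (q o : T -> R) : 0 < eps ->
  entropy_density P r q -> measurable_fun setT o -> (forall z, 0 <= o z <= e z) ->
  \int[P]_z expR ((`|r| + 1) / eps * o z) <= 2 ->
  P.-integrable setT (EFin \o (fun z => q z * o z)) /\ \int[P]_z (q z * o z) <= eps.
Proof.
move=> eps0 hq mo oe o2.
have r10 : 0 < `|r| + 1 by rewrite ltr_pwDr.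
have a0 : 0 < (`|r| + 1) / eps by rewrite divr_gt0.
have [|i1 i2] := entropy_density_moment hq mo (fun z => proj1 (andP (oe z))) a0.
  apply: all_exp_moments_integrable; apply: all_exp_moments_dominated me _ => // z.
  by have /andP[? ?] := oe z; rewrite ger0_norm.
split => //; apply: le_trans i2 _.
rewrite ler_pdivrMl// divfK ?gt_eqF//.
by have := ler_norm r; lra.
Qed.

(** The parameter varies with [eps]. Replacing it by a cluster point [th] costs only the mean of the
    local oscillation at [th], which the entropy bound keeps small; the constraints then all refer
    to one parameter. *)
Lemma near_optimal_closure r :
  (forall eps, 0 < eps -> exists th q, A th /\ near_optimal (r + eps) eps th q) ->
  exists th q, A th /\ near_optimal r 0 th q.
Proof.
move=> h.
pose S (eps : R) := [set th | A th /\ exists q, near_optimal (r + eps) eps th q].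
pose F := filter_from [set eps : R | 0 < eps] S.
have FF : ProperFilter F.
  apply: filter_from_proper; last first.
    by move=> eps /= /h[th [q [Ath hq]]]; exists th; split => //; exists q.
  apply: filter_from_filter; first by exists 1 => /=.
  move=> e1 e2 /= e10 e20; exists (Num.min e1 e2); first by rewrite /= lt_min e10.
  move=> th [Ath [q [q1 q2]]].
  have m1 : Num.min e1 e2 <= e1 by rewrite ge_min lexx.
  have m2 : Num.min e1 e2 <= e2 by rewrite ge_min lexx orbT.
  split; split => //; exists q; split.
  - by apply: entropy_density_weaken q1; lra.
  - by move=> th' /q2; lra.
  - by apply: entropy_density_weaken q1; lra.
  - by move=> th' /q2; lra.
have [th [Ath clth]] : A `&` cluster F !=set0.
  by apply: cA; exists 1 => //= th [].
have Bth := AB Ath.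
have [|eps eps0|q hq qG] := @entropy_closure _ _ _ P r
    [set g | exists2 th', B th' & g = fun z => l th z - l th' z].
- by move=> _ [th' Bth' ->]; exact: ediff.
(* One half pays for the slack of [th1], the other for moving from [th1] to [th]. *)
- pose ep := eps / 2; have ep0 : 0 < ep by rewrite divr_gt0.
  have a0 : 0 < (`|r + ep| + 1) / ep by rewrite divr_gt0// ltr_pwDr.
  have [os [U [nU mo oe o2 oU]]] := local_oscillation cB ml cl me le Bth a0.
  have [th1 [[Ath1 [q [q1 q2]]] Uth1]] : S ep `&` U !=set0.
    by apply: clth => //; exists ep.
  have Bth1 := AB Ath1.
  exists q; first by apply: entropy_density_weaken q1; rewrite /ep; lra.
  move=> _ [th' Bth' ->].
  have [i1 i2] := moment_small ep0 q1 mo oe o2.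
  have ia := entropy_density_integrable q1 (ediff Bth1 Bth').
  apply: (@le_trans _ _ (\int[P]_x (q x * (l th1 x - l th' x) - q x * os x))).
    by rewrite RintegralB//; have := q2 _ Bth'; move: i2; rewrite /ep; lra.
  apply: le_Rintegral => //.
  + exact: rintegrableB.
  + exact: entropy_density_integrable q1 (ediff Bth Bth').
  + move=> x _; rewrite -mulrBr; apply: ler_wpM2l; first exact: ed_ge0 q1 _.
    have := oU th1 x Bth1 Uth1; rewrite ler_norml => /andP[_ h1].
    lra.
- exists th, q; split => //; split => // th' Bth'; rewrite oppr0.
  by apply: qG; exists th'.
Qed.

(** * From a likely event to a near-optimal density *)

Section large_deviations.
Context dO (Omega : measurableType dO) (Prob : probability Omega R).
Variable Zs : nat -> Omega -> T.
Hypothesis Zs_meas : forall i, measurable_fun setT (Zs i).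
Hypothesis Zs_law : forall i A, measurable A -> Prob (Zs i @^-1` A) = P A.
Hypothesis Zs_indep : forall (n : nat) (A : nat -> set T),
  (forall i, measurable (A i)) ->
  Prob (\bigcap_(i in `I_n) (Zs i @^-1` A i)) =
    (\prod_(i < n) Prob (Zs i @^-1` A i))%E.
Variables (E : nat -> set Omega) (dl : nat -> R).
Hypothesis mE : forall n, measurable (E n).
Hypothesis dl0 : dl @ \oo --> 0.
Hypothesis E_near_sup : forall n w (eta : R), (0 < n)%N -> E n w -> 0 < eta ->
  exists2 th, A th & forall th', B th' ->
    \sum_(i < n) l th' (Zs i w) <= \sum_(i < n) l th (Zs i w) + n%:R * dl n + eta.
Hypothesis msup : forall n (X : Omega -> R), measurable_fun setT X ->
  measurable [set w | forall th', B th' -> \sum_(i < n) l th' (Zs i w) <= X w].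

Lemma exp_likely_near_optimal r' r : r' < r -> exp_likely Prob E r' ->
  exists th q, A th /\ near_optimal r 0 th q.
Proof.
move=> rr' hr'; apply: near_optimal_closure => eps eps0.
(* The thirds cover the normalised penalty [dl n], the slack of the approximate maximiser and the
   mean oscillation. *)
pose ep := eps / 3; have ep0 : 0 < ep by rewrite divr_gt0.
have a0 : 0 < (`|r| + 1) / ep by rewrite divr_gt0// ltr_pwDr.
have [os [ts [tA [ho hcov]]]] := oscillation_cover cB ml cl me le cA AB a0.
have /cvgrPdist_le/(_ _ ep0)[N1 _ hN1] := dl0.
have rr0 : 0 < r - r' by lra.
have [N2 hN2] := exp_dominates_nat (size ts) rr0.
have [n nN Plow] := hr' (maxn 1 (maxn N1 N2)).
move: nN; rewrite !geq_max => /and3P[n1 nN1 nN2].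
have nR0 : 0 < n%:R :> R by rewrite ltr0n.
pose g t th' z := l t z + os t z - l th' z.
(* The random near-maximiser gives way to a fixed net point [t], with [os t] added so that
   [l t + os t] dominates it. Each [E' t] is then a family of linear constraints on the empirical
   measure. *)
pose E' t := [set w | forall th', B th' -> \sum_(i < n) l th' (Zs i w) <=
   \sum_(i < n) (l t (Zs i w) + os t (Zs i w)) + n%:R * (2 * ep)].
have mE' t : t \in ts -> measurable (E' t).
  move=> tts; apply: msup; apply: measurable_funD => //.
  apply: measurable_sum => i; apply: measurable_funD; apply: measurableT_comp => //.
    exact/ml/AB/tA.
  by have [] := ho _ (tA _ tts).
have EE' w : E n w -> exists2 t, t \in ts & E' t w.
  move=> Ew; have [th Ath hth] := E_near_sup n1 Ew (mulr_gt0 nR0 ep0).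
  have [t tts ht] := hcov _ Ath; exists t => // th' Bth'.
  apply: le_trans (hth _ Bth') _.
  have dlep : dl n <= ep.
    by have := hN1 n nN1; rewrite sub0r normrN; apply: le_trans; exact: ler_norm.
  have h1 : \sum_(i < n) l th (Zs i w) <= \sum_(i < n) (l t (Zs i w) + os t (Zs i w)).
    apply: ler_sum => i _; have := ht (Zs i w).
    by rewrite ler_norml => /andP[_ ?]; lra.
  have := ler_wpM2l (ltW nR0) dlep; lra.
have [t tts Pt] : exists2 t, t \in ts & ((expR (- (n%:R * r)))%:E <= Prob (E' t))%E.
  apply: contrapT => hno.
  have hlt t : t \in ts -> (Prob (E' t) <= (expR (- (n%:R * r)))%:E)%E.
    by move=> tts; rewrite leNgt; apply/negP => ?; apply: hno; exists t => //; exact: ltW.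
  have := probability_finite_cover_le (mE n) mE' EE' hlt.
  rewrite leNgt => /negP; apply; apply: le_lt_trans Plow; rewrite lee_fin.
  apply: (@le_trans _ _ (expR (n%:R * (r - r')) * expR (- (n%:R * r)))).
    by apply: ler_wpM2r; [exact: expR_ge0|exact: hN2].
  by rewrite -expRD ler_expR; lra.
have At := tA _ tts; have [mo oe o2] := ho _ At.
have [q hq qg] := conditioned_entropy_density Zs_meas Zs_law Zs_indep n1 (mE' _ tts) Pt.
exists t, q; split => //; split.
  by apply: entropy_density_weaken hq; lra.
move=> th' Bth'; have Bt := AB At.
have eg : all_exp_moments P (g t th').
  apply: all_exp_moments_dominated (em 2) _ => [|z].
    apply: measurable_funB; last exact: ml.
    by apply: measurable_funD => //; exact: ml.
  rewrite /g addrAC mulr_natl mulr2n.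
  apply: le_trans (ler_normD _ _) _; apply: lerD; first exact: le.
  by have /andP[? ?] := oe z; rewrite ger0_norm.
have h1 : - (2 * ep) <= \int[P]_x (q x * g t th' x).
  apply: qg => // w /(_ _ Bth') hw.
  have -> : \sum_(i < n) g t th' (Zs i w) =
    \sum_(i < n) (l t (Zs i w) + os t (Zs i w)) - \sum_(i < n) l th' (Zs i w).
    by rewrite -sumrB.
  by rewrite mulrN; lra.
have [i1 i2] := moment_small ep0 hq mo oe o2.
have ig := entropy_density_integrable hq eg.
rewrite (_ : (fun x => _) = (fun x => q x * g t th' x - q x * os t x)); last first.
  by apply/funext => x; rewrite /g; ring.
by rewrite RintegralB//; move: h1 i2; rewrite /ep; lra.
Qed.

End large_deviations.

End model_pair.

(** * The Orlicz space [L_tau] against densities of finite entropy *)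

Section orlicz.
Context d (T : measurableType d) (R : realType) (P : probability T R).
Implicit Types (f q : T -> R) (s c : R).

Lemma tau_ge0 s : 0 <= tau s.
Proof. by rewrite /tau; have := expR_ge1Dx `|s|; lra. Qed.

(** This amounts to [2 t <= exp t], the product of [2 <= exp 1] and [t <= exp (t - 1)]. *)
Lemma expR_le_tau s : expR `|s| <= 2 * tau s + 2.
Proof.
rewrite /tau; set t := `|s|.
have h1 : 2 <= expR 1 :> R by have := @expR_ge1Dx R 1; lra.
have h2 : t <= expR (t - 1) by have := expR_ge1Dx (t - 1); lra.
have : 2 * t <= expR 1 * expR (t - 1).
  by apply: ler_pM => //; rewrite normr_ge0.
by rewrite -expRD addrC subrK; lra.
Qed.

(** Convexity of [tau] and [tau 0 = 0]; it allows a finite [tau] integral to be scaled below [1]. *)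
Lemma tau_div_le s c : 1 <= c -> tau (s / c) <= c^-1 * tau s.
Proof.
move=> c1; have c0 : 0 < c by lra.
rewrite ler_pdivlMl// /tau normrM [`|c^-1|]ger0_norm; last by rewrite invr_ge0 ltW.
set u := `|s| / c; have -> : `|s| = c * u by rewrite mulrC divfK// gt_eqF.
have u0 : 0 <= u by rewrite divr_ge0// ltW.
have h1 : expR (c * u) = expR u * expR ((c - 1) * u) by rewrite -expRD; congr expR; ring.
have h2 : 1 + (c - 1) * u <= expR ((c - 1) * u) by exact: expR_ge1Dx.
have h3 : expR u * (1 - u) <= 1.
  have := ler_wpM2l (expR_ge0 u) (expR_ge1Dx (- u)).
  by rewrite -expRD subrr expR0.
have h4 : expR u * (1 + (c - 1) * u) <= expR (c * u).
  by rewrite h1 ler_wpM2l ?expR_ge0.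
have h5 : 0 <= (c - 1) * (1 - expR u * (1 - u)) by rewrite mulr_ge0; lra.
by move: h4 h5; move: (expR u) (expR (c * u)) => x y h4 h5; nra.
Qed.

Lemma measurable_fun_tau f : measurable_fun setT f ->
  measurable_fun setT (fun x => tau (f x)).
Proof.
move=> mf; rewrite /tau; have mn : measurable_fun setT (fun x => `|f x|).
  exact: measurableT_comp.
apply: measurable_funB => //; apply: measurable_funB => //.
exact: measurableT_comp.
Qed.

Lemma tau_exp_integrable f : measurable_fun setT f ->
  (\int[P]_x (tau (f x))%:E < +oo)%E ->
  P.-integrable setT (EFin \o (fun x => expR `|f x|)) /\
  \int[P]_x expR `|f x| <= 2 * \int[P]_x tau (f x) + 2.
Proof.
move=> mf ioo.
have it : P.-integrable setT (EFin \o (fun x => tau (f x))).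
  by apply: rintegrable_ge0 => // [|x]; [exact: measurable_fun_tau|exact: tau_ge0].
have ib : P.-integrable setT (EFin \o (fun x => 2 * tau (f x) + 2)).
  by apply: rintegrableD; [exact: rintegrableZ|exact: rintegrable_cst].
have ie : P.-integrable setT (EFin \o (fun x => expR `|f x|)).
  apply: rintegrable_dominated ib _.
    by do 2 apply: measurableT_comp => //.
  by move=> x; rewrite ger0_norm ?expR_ge0// expR_le_tau.
split => //.
apply: le_trans (le_Rintegral measurableT ie ib (fun x _ => expR_le_tau (f x))) _.
rewrite RintegralD//; [|exact: rintegrableZ|exact: rintegrable_cst].
by rewrite RintegralZl// Rintegral_probability_cst.
Qed.

Lemma Mtau_all_exp_moments f : Mtau P f -> all_exp_moments P f.
Proof.
move=> [mf h]; split => // a a0.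
have aV0 : 0 < a^-1 by rewrite invr_gt0.
have [|ie _] := tau_exp_integrable _ (h _ aV0); first exact: measurable_funM.
move: ie; congr (_.-integrable _ (_ \o _)); apply/funext => x.
by rewrite invrK normrM mulrC (ger0_norm (ltW a0)).
Qed.

(** The infimum defining [tau_norm] is thereby taken over a nonempty set, not at its default
    value. *)
Lemma tau_ball_neq0 f : Ltau P f ->
  exists a, 0 < a /\ (\int[P]_x (tau (f x / a))%:E <= 1)%E.
Proof.
move=> [mf [a [a0 ioo]]].
have mfa : measurable_fun setT (fun x => f x / a) by exact: measurable_funM.
have it : P.-integrable setT (EFin \o (fun x => tau (f x / a))).
  by apply: rintegrable_ge0 => // [|x]; [exact: measurable_fun_tau|exact: tau_ge0].
pose c := Num.max 1 (\int[P]_x tau (f x / a)).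
have c1 : 1 <= c by rewrite le_max lexx.
have c0 : 0 < c by lra.
have cI : \int[P]_x tau (f x / a) <= c by rewrite le_max lexx orbT.
exists (a * c); split; first by rewrite mulr_gt0.
have le x : tau (f x / (a * c)) <= c^-1 * tau (f x / a).
  by rewrite invfM mulrA; exact: tau_div_le.
have mfac : measurable_fun setT (fun x => f x / (a * c)) by exact: measurable_funM.
have it' : P.-integrable setT (EFin \o (fun x => tau (f x / (a * c)))).
  apply: rintegrable_dominated (rintegrableZ c^-1 it) _.
    exact: measurable_fun_tau.
  by move=> x; rewrite ger0_norm ?tau_ge0.
rewrite -EFin_Rintegral// lee_fin.
apply: le_trans (le_Rintegral measurableT it' (rintegrableZ c^-1 it) (fun x _ => le x)) _.
by rewrite RintegralZl// ler_pdivrMl// mulr1.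
Qed.

Variables (r : R) (q : T -> R).
Hypothesis hq : entropy_density P r q.

(** Every scale [a] admissible in the norm gives the bound [(|r| + 3) * a]: the exponential moment
    is at most [2 * 1 + 2], and [r + 4 - 1 = r + 3]. The infimum over [a] follows. *)
Lemma entropy_density_Ltau f : Ltau P f ->
  P.-integrable setT (EFin \o (fun x => q x * `|f x|)) /\
  \int[P]_x (q x * `|f x|) <= (`|r| + 3) * tau_norm P f.
Proof.
move=> Lf; have [mf _] := Lf.
have bound a : 0 < a -> (\int[P]_x (tau (f x / a))%:E <= 1)%E ->
  P.-integrable setT (EFin \o (fun x => q x * `|f x|)) /\
  \int[P]_x (q x * `|f x|) <= (`|r| + 3) * a.
  move=> a0 t1; have mfa : measurable_fun setT (fun x => f x / a) by exact: measurable_funM.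
  have aV0 : 0 < a^-1 by rewrite invr_gt0.
  have [ie le] := tau_exp_integrable mfa (le_lt_trans t1 (ltry _)).
  have E : (fun x => expR `|f x / a|) = (fun x => expR (a^-1 * `|f x|)).
    by apply/funext => x; rewrite normrM mulrC [`|a^-1|]ger0_norm// ltW.
  rewrite E in ie le.
  have [||||i1 i2] := @entropy_density_moment _ _ _ P r q (fun x => `|f x|) a^-1 hq.
  - exact: measurableT_comp.
  - by [].
  - by [].
  - by [].
  - split => //; apply: le_trans i2 _; rewrite invrK mulrC; apply: ler_wpM2r; first exact: ltW.
    have it : P.-integrable setT (EFin \o (fun x => tau (f x / a))).
      apply: rintegrable_ge0 => // [|x|]; [exact: measurable_fun_tau|exact: tau_ge0|].
      exact: le_lt_trans t1 (ltry _).
    have : \int[P]_x tau (f x / a) <= 1 by rewrite -lee_fin EFin_Rintegral.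
    by have := ler_norm r; lra.
have [a0 [a00 ha0]] := tau_ball_neq0 Lf.
have [i0 _] := bound _ a00 ha0; split => //.
have r30 : 0 < `|r| + 3 by have := normr_ge0 r; lra.
rewrite -ler_pdivrMl//; apply: lb_le_inf; first by exists a0.
by move=> a [a1 ha]; rewrite ler_pdivrMl//; case: (bound _ a1 ha).
Qed.

Variable Q : probability T R.
Hypothesis Qq : forall A, measurable A -> Q A = (\int[P]_(x in A) (q x)%:E)%E.

Lemma density_integrable f : measurable_fun setT f ->
  Q.-integrable setT (EFin \o f) <-> P.-integrable setT (EFin \o (fun x => q x * f x)).
Proof.
move=> mf; have := @integrable_weighted_pushforward _ _ _ _ _ P Q id q (@measurable_id _ T setT)
  (ed_measurable hq) (ed_ge0 hq) Qq f mf.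
by under [in X in _ <-> X -> _]eq_fun do rewrite mulrC.
Qed.

Lemma density_Rintegral f : Q.-integrable setT (EFin \o f) ->
  \int[Q]_x f x = \int[P]_x (q x * f x).
Proof.
move=> iQ; rewrite (@Rintegral_weighted_pushforward _ _ _ _ _ P Q id q (@measurable_id _ T setT)
  (ed_measurable hq) (ed_ge0 hq) Qq f iQ).
by apply: eq_Rintegral => x _; rewrite mulrC.
Qed.

Lemma density_Ltau_integrable f : Ltau P f -> Q.-integrable setT (EFin \o f).
Proof.
move=> Lf; have [mf _] := Lf; apply/(density_integrable mf).
have [i0 _] := entropy_density_Ltau Lf; apply: rintegrable_dominated i0 _.
  by apply: measurable_funM => //; exact: ed_measurable hq.
by move=> x; rewrite normrM ger0_norm//; exact: ed_ge0 hq _.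
Qed.

Lemma density_prob_in_dual : prob_in_dual P Q.
Proof.
split; first exact: density_Ltau_integrable.
split; [|split].
- move=> f g /density_Ltau_integrable hf /density_Ltau_integrable hg.
  exact: (RintegralD measurableT hf hg).
- move=> c f /density_Ltau_integrable hf.
  exact: (RintegralZl c measurableT hf).
- exists (`|r| + 3) => f Lf; have iQ := density_Ltau_integrable Lf.
  rewrite -/(Rintegral Q setT f) density_Rintegral//.
  have [mf _] := Lf; have [i0 le] := entropy_density_Ltau Lf.
  apply: le_trans le; apply: le_trans (le_normr_Rintegral measurableT _) _.
    exact/(density_integrable mf).
  rewrite le_eqVlt; apply/orP; left; apply/eqP; apply: eq_Rintegral => x _.
  by rewrite normrM ger0_norm//; exact: ed_ge0 hq _.
Qed.

Lemma density_Qset : Qset P (integral_functional Q).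
Proof.
left; split; first by case: density_prob_in_dual.
split; last exact: (Rintegral_probability_cst Q 1).
move=> f Lf f0; have iQ := density_Ltau_integrable Lf; have [mf _] := Lf.
rewrite /integral_functional -/(Rintegral Q setT f) density_Rintegral//.
rewrite (_ : \int[P]_x _ = \int[P]_x (q x * `|f x|)).
  by apply: Rintegral_ge0 => x _; rewrite mulr_ge0//; exact: ed_ge0 hq _.
have mq := ed_measurable hq.
congr fine; apply: ae_eq_integral => //.
- by apply/measurable_EFinP; exact: measurable_funM.
- by apply/measurable_EFinP; apply: measurable_funM => //; exact: measurableT_comp.
- by apply: filterS f0 => x fx0 _; rewrite (ger0_norm fx0).
Qed.

Lemma density_KL_le : (KL Q P <= r%:E)%E.
Proof.
apply: (@le_trans _ _ (\int[P]_x (xlnx (q x))%:E)%E).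
  by apply: ereal_inf_lbound; exists q => //; split; [exact: ed_measurable hq|split => //; exact: ed_ge0 hq].
by rewrite -EFin_Rintegral ?lee_fin; [exact: ed_xlnx_le hq|exact: ed_xlnx_integrable hq].
Qed.

End orlicz.

(** * Finite relative entropy, and equality cases *)

Lemma KL_lt_entropy_density d (T : measurableType d) (R : realType)
    (P Q : probability T R) (r : R) : (KL Q P < r%:E)%E ->
  exists2 q, entropy_density P r q &
    forall A, measurable A -> Q A = (\int[P]_(x in A) (q x)%:E)%E.
Proof.
move=> /ereal_inf_lt[_ [q [mq [q0 qA]] <-] lt]; exists q => //.
have c1 : (\int[P]_x 1%:E = 1)%E.
  by rewrite -(EFin_Rintegral (rintegrable_cst P 1)) Rintegral_probability_cst.
have Q1 : (\int[P]_x (q x)%:E = 1)%E by rewrite -qA// probability_setT.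
have iq : P.-integrable setT (EFin \o q).
  by apply: rintegrable_ge0 => //; rewrite Q1 ltry.
have mx : measurable_fun setT (fun x => xlnx (q x)) by exact: measurable_fun_xlnx.
(* Since [xlnx >= -1], the negative part has integral at most [1], so an upper bound on the extended
   integral also bounds the positive part. *)
have ix : P.-integrable setT (EFin \o (fun x => xlnx (q x))).
  have h : (\int[P]_x (xlnx (q x) + 1)%:E < +oo)%E.
    have neg : (\int[P]_x ((EFin \o (fun x => xlnx (q x)))^\- x) <= 1)%E.
      rewrite -[leRHS]c1.
      apply: ge0_le_integral => //.
      - by apply: measurable_funeneg; exact/measurable_EFinP.
      - move=> x _; rewrite funenegE ge_max [X in _ && X]lee_fin ler01 andbT /= lee_fin.
        by have := xlnx_ge_N1 (q0 x); lra.
    have pos : (\int[P]_x ((EFin \o (fun x => xlnx (q x)))^\+ x) < +oo)%E.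
      have gen (x y : \bar R) : (y <= 1 -> x - y < r%:E -> x < +oo)%E.
        by case: x => [x| |]; case: y => [y| |] //= *; rewrite ?ltry.
      by apply: gen neg _; rewrite -integralE; exact: lt.
    apply: le_lt_trans (lte_add_pinfty pos (ltry 1)).
    rewrite -[X in (_ + X)%E]c1.
    rewrite -ge0_integralD//; last by apply: measurable_funepos; exact/measurable_EFinP.
    apply: ge0_le_integral => //.
    - by move=> x _; rewrite lee_fin; have := xlnx_ge_N1 (q0 x); lra.
    - by apply/measurable_EFinP; exact: measurable_funD.
    - apply: emeasurable_funD => //; apply: measurable_funepos; exact/measurable_EFinP.
    - by move=> x _; rewrite EFinD leeD2r// funeposE le_max lexx.
  have : P.-integrable setT (EFin \o (fun x => xlnx (q x) + 1)).
    apply: rintegrable_ge0 => //; first exact: measurable_funD.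
    by move=> x; have := xlnx_ge_N1 (q0 x); lra.
  move=> h'; have := rintegrableB h' (rintegrable_cst P 1).
  by congr (_.-integrable _ (_ \o _)); apply/funext => x; rewrite addrK.
split => //.
- by rewrite /Rintegral Q1.
- by rewrite -lee_fin EFin_Rintegral// ltW.
Qed.

Section almost_everywhere.
Context d (T : measurableType d) (R : realType) (P : probability T R).
Implicit Types f g q : T -> R.

Lemma ae_eq_Rintegral f g : measurable_fun setT f -> measurable_fun setT g ->
  {ae P, forall x, f x = g x} -> \int[P]_x f x = \int[P]_x g x.
Proof.
move=> mf mg fg; congr fine; apply: ae_eq_integral => //.
- exact/measurable_EFinP.
- exact/measurable_EFinP.
- by apply: filterS fg => x -> _.
Qed.

Lemma ge0_Rintegral_le0_ae f : P.-integrable setT (EFin \o f) ->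
  (forall x, 0 <= f x) -> \int[P]_x f x <= 0 -> {ae P, forall x, f x = 0}.
Proof.
move=> i0 f0 le0.
have I0 : (\int[P]_x (f x)%:E = 0)%E.
  rewrite -EFin_Rintegral//; congr EFin; apply/eqP; rewrite eq_le le0.
  exact: Rintegral_ge0.
have mf : measurable_fun setT (EFin \o f) by case/integrableP: i0.
have : (\int[P]_x `|(EFin \o f) x|)%E = 0%E.
  by under eq_integral do rewrite /= ger0_norm//.
move=> /(ae_eq_integral_abs _ measurableT mf); apply: filterS => x /(_ Logic.I).
by move=> [].
Qed.

(* The Hellinger lower bounds turn equality in Gibbs' inequality into equality
   of the densities. *)
Lemma sqrt_sub1_integral_le0_ae f g : measurable_fun setT f -> (forall x, 0 <= f x) ->
  P.-integrable setT (EFin \o g) -> (forall x, (Num.sqrt (f x) - 1) ^+ 2 <= g x) ->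
  \int[P]_x g x <= 0 -> {ae P, forall x, f x = 1}.
Proof.
move=> mf f0 ig fg g0.
apply: filterS (ge0_Rintegral_le0_ae ig _ g0) => [x gx0|x].
  have : (Num.sqrt (f x) - 1) ^+ 2 = 0.
    by apply/eqP; rewrite eq_le sqr_ge0 andbT -gx0.
  move=> /eqP; rewrite sqrf_eq0 subr_eq0 => /eqP fx1.
  by rewrite -(sqr_sqrtr (f0 x)) fx1 expr1n.
exact: le_trans (sqr_ge0 _) (fg x).
Qed.

Lemma entropy_density_le0 q : entropy_density P 0 q -> {ae P, forall x, q x = 1}.
Proof.
move=> [mq q0 iq q1 ixq q_le].
apply: (@sqrt_sub1_integral_le0_ae q (fun x => xlnx (q x) - q x + 1)) => //.
- by apply: rintegrableD; [exact: rintegrableB|exact: rintegrable_cst].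
- move=> x; have := xlnx_tangent_hellinger (q0 x) ltr01.
  by rewrite sqrtr1 ln1 mulr0 subr0.
- rewrite RintegralD//; [|exact: rintegrableB|exact: rintegrable_cst].
  by rewrite RintegralB// q1 Rintegral_probability_cst; lra.
Qed.

End almost_everywhere.

(** * Inequalities between suprema versus near-optimal parameters *)

Section model_suprema.
Context d (T : measurableType d) (R : realType) (P : probability T R).
Variables (Th : pseudoMetricType R) (A B : set Th) (l : Th -> T -> R) (e : T -> R).
Hypothesis AB : A `<=` B.
Hypothesis Ll : forall th, B th -> Ltau P (l th).
Hypothesis me : all_exp_moments P e.
Hypothesis le : forall th th' z, B th -> B th' -> `|l th z - l th' z| <= e z.

Let ml th : B th -> measurable_fun setT (l th).
Proof. by move=> /Ll[]. Qed.

Lemma optimal_supQ (phi : (T -> R) -> R) th : A th ->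
  (forall th', B th' -> phi (l th') <= phi (l th)) ->
  (- 0%:E <= supQ l A phi - supQ l B phi)%E.
Proof.
move=> Ath opt.
have BE : supQ l B phi = (phi (l th))%:E.
  apply/eqP; rewrite eq_le; apply/andP; split.
    by apply: ge_ereal_sup => _ [th' Bth' <-]; rewrite lee_fin opt.
  by apply: ereal_sup_ubound; exists th => //; exact: AB.
have AE : supQ l A phi = (phi (l th))%:E.
  apply/eqP; rewrite eq_le; apply/andP; split.
    by apply: ge_ereal_sup => _ [th' Ath' <-]; rewrite lee_fin opt//; exact: AB.
  by apply: ereal_sup_ubound; exists th.
by rewrite AE BE -EFinN -EFinB lee_fin subrr oppr0.
Qed.

(** The bound [M] makes both suprema finite, so their extended difference can be read as a real one;
    an empty [A] would make it [-oo]. *)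
Lemma supQ_optimal (phi : (T -> R) -> R) (M eps : R) : 0 < eps ->
  (forall th th', B th -> B th' -> phi (l th) <= phi (l th') + M) ->
  (- 0%:E <= supQ l A phi - supQ l B phi)%E ->
  exists2 th, A th & forall th', B th' -> phi (l th') <= phi (l th) + eps.
Proof.
move=> eps0 bd h.
have [[th0 Ath0]|A0] := pselect (A !=set0); last first.
  move: h; rewrite {1}/supQ (_ : [set _ | th in A] = set0) ?ereal_sup0//.
  by apply/seteqP; split => // t [th Ath _]; case: A0; exists th.
have supA_ge : ((phi (l th0))%:E <= supQ l A phi)%E.
  by apply: ereal_sup_ubound; exists th0.
have supB_ge th : B th -> ((phi (l th))%:E <= supQ l B phi)%E.
  by move=> Bth; apply: ereal_sup_ubound; exists th.
have supA_le : (supQ l A phi <= (phi (l th0) + M)%:E)%E.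
  apply: ge_ereal_sup => _ [th Ath <-]; rewrite lee_fin bd//; exact: AB.
have supB_le : (supQ l B phi <= (phi (l th0) + M)%:E)%E.
  apply: ge_ereal_sup => _ [th Bth <-]; rewrite lee_fin bd//; exact: AB.
have fA : supQ l A phi \is a fin_num.
  rewrite fin_numE; apply/andP; split.
    by apply/eqP => hy; move: supA_ge; rewrite hy.
  by apply/eqP => hy; move: supA_le; rewrite hy.
have fB : supQ l B phi \is a fin_num.
  rewrite fin_numE; apply/andP; split.
    by apply/eqP => hy; have := supB_ge th0 (AB Ath0); rewrite hy.
  by apply/eqP => hy; move: supB_le; rewrite hy.
have [_ [th Ath <-] hth] := ub_ereal_sup_adherent eps0 fA.
exists th => // th' /supB_ge.
move: h hth; rewrite -/(supQ l A phi) -(fineK fA) -(fineK fB).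
by rewrite -EFinN -!EFinB !lee_fin lte_fin; lra.
Qed.

Lemma near_optimal_probs_in r th q : A th -> near_optimal P B l r 0 th q ->
  exists Q : probability T R, [/\ (KL Q P <= r%:E)%E, prob_in_dual P Q,
    Qset P (integral_functional Q) &
    (- 0%:E <= supQ l A (integral_functional Q) - supQ l B (integral_functional Q))%E].
Proof.
move=> Ath [hq opt].
have q1 : (\int[P]_x (q x)%:E = 1)%E.
  by rewrite -EFin_Rintegral ?(ed_mass hq)//; exact: ed_integrable hq.
have [Q QE] := exists_weighted_law (@measurable_id _ T setT) (ed_measurable hq) (ed_ge0 hq) q1.
have Qq A0 : measurable A0 -> Q A0 = (\int[P]_(x in A0) (q x)%:E)%E by move=> _; exact: QE.
exists Q; split.
- exact: (density_KL_le hq Qq).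
- exact: (density_prob_in_dual hq Qq).
- exact: (density_Qset hq Qq).
- apply: (optimal_supQ Ath) => th' Bth'.
  have i1 := density_Ltau_integrable hq Qq (Ll Bth').
  have i2 := density_Ltau_integrable hq Qq (Ll (AB Ath)).
  rewrite /integral_functional -!/(Rintegral Q setT _).
  rewrite -subr_ge0 -RintegralB// (density_Rintegral hq Qq); last exact: rintegrableB.
  by have := opt _ Bth'; rewrite oppr0.
Qed.

(** The supremum over [A] is approached up to [eps], hence the slack; [0 + eps] matches the
    hypothesis of [near_optimal_closure] at entropy [0]. *)
Lemma probs_in_near_optimal (Q : probability T R) (eps : R) : 0 < eps ->
  (KL Q P < eps%:E)%E ->
  (- 0%:E <= supQ l A (integral_functional Q) - supQ l B (integral_functional Q))%E ->
  exists th q, A th /\ near_optimal P B l (0 + eps) eps th q.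
Proof.
move=> eps0 KLe h; rewrite add0r.
have [q hq Qq] := KL_lt_entropy_density KLe.
have iQ th : B th -> Q.-integrable setT (EFin \o l th).
  by move=> Bth; exact: (density_Ltau_integrable hq Qq (Ll Bth)).
have ie : Q.-integrable setT (EFin \o e).
  apply/(density_integrable hq Qq); first by case: me.
  exact: entropy_density_integrable hq me.
have [|th Ath opt] := @supQ_optimal (integral_functional Q) (\int[Q]_x e x) eps eps0 _ h.
  move=> th th' Bth Bth'; rewrite /integral_functional -!/(Rintegral Q setT _).
  rewrite -RintegralD//; last exact: iQ.
  apply: le_Rintegral => //; [exact: iQ|by apply: rintegrableD => //; exact: iQ|].
  by move=> x _; have := le x Bth Bth'; rewrite ler_norml => /andP[_]; lra.
exists th, q; split => //; split => // th' Bth'.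
rewrite -(density_Rintegral hq Qq); last by apply: rintegrableB; apply: iQ => //; exact: AB.
rewrite RintegralB//; [|exact/iQ/AB|exact: iQ].
have := opt _ Bth'; rewrite /integral_functional -!/(Rintegral Q setT _); lra.
Qed.

Lemma near_optimal_zero_entropy th q : B th -> near_optimal P B l 0 0 th q ->
  forall th', B th' -> 0 <= \int[P]_x (l th x - l th' x).
Proof.
move=> Bth [hq opt] th' Bth'; have := opt _ Bth'; rewrite oppr0.
have md : measurable_fun setT (fun x => l th x - l th' x).
  by apply: measurable_funB; exact: ml.
rewrite (@ae_eq_Rintegral _ _ _ P _ (fun x => l th x - l th' x))//.
  by apply: measurable_funM => //; exact: ed_measurable hq.
by apply: filterS (entropy_density_le0 hq) => x ->; rewrite mul1r.
Qed.

End model_suprema.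

(** * Laws given by log-densities *)

Section log_densities.
Context d (T : measurableType d) (R : realType).
Variables (mu : {measure set T -> \bar R}) (P P1 : probability T R) (l0 l1 : T -> R).
Hypothesis ml0 : measurable_fun setT l0.
Hypothesis ml1 : measurable_fun setT l1.
Hypothesis PE : forall A, measurable A -> P A = (\int[mu]_(x in A) (expR (l0 x))%:E)%E.
Hypothesis P1E : forall A, measurable A -> P1 A = (\int[mu]_(x in A) (expR (l1 x))%:E)%E.
Hypothesis il : P.-integrable setT (EFin \o (fun x => l0 x - l1 x)).

Let ge0_integral_density (Q : probability T R) (k g : T -> R) :
  measurable_fun setT k -> measurable_fun setT g -> (forall x, 0 <= g x) ->
  (forall A, measurable A -> Q A = (\int[mu]_(x in A) (expR (k x))%:E)%E) ->
  forall A, measurable A ->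
  (\int[Q]_(x in A) (g x)%:E = \int[mu]_(x in A) (g x * expR (k x))%:E)%E.
Proof.
move=> mk mg g0 QE A mA.
have mek : measurable_fun setT (fun x => expR (k x)) by exact: measurableT_comp.
rewrite [LHS]integral_mkcond.
transitivity (\int[mu]_x (((fun x => (g x)%:E) \_ A) x * (expR (k x))%:E))%E.
  apply: (ge0_integral_weighted_pushforward (@measurable_id _ T setT) mek
    (fun x => expR_ge0 _) QE).
  - apply/(measurable_restrictT _ mA)/measurable_funTS; exact/measurable_EFinP.
  - by move=> x; rewrite patchE; case: ifP => _ //; rewrite lee_fin.
rewrite [RHS]integral_mkcond; apply: eq_integral => x _ /=.
by rewrite !patchE; case: ifP => _; rewrite ?mul0e// EFinM.
Qed.

(** Exponential densities never vanish, so their quotient is a density with no exceptional set. *)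
Lemma density_exp_sub A : measurable A ->
  P A = (\int[P1]_(x in A) (expR (l0 x - l1 x))%:E)%E.
Proof.
move=> mA; rewrite (ge0_integral_density ml1)//.
- rewrite PE//; apply: eq_integral => x _.
  by rewrite -expRD subrK.
- by apply: measurableT_comp => //; exact: measurable_funB.
Qed.

(** Every density in the infimum defining [KL] agrees almost everywhere with [exp (l0 - l1)], so
    that infimum ranges over a single value. *)
Lemma KL_log_densities : KL P P1 = (\int[P]_x (l0 x - l1 x))%:E.
Proof.
pose g0 x := expR (l0 x - l1 x).
have mg0 : measurable_fun setT g0 by apply: measurableT_comp => //; exact: measurable_funB.
have g00 x : 0 <= g0 x by exact: expR_ge0.
have Pg0 := density_exp_sub.
have md : measurable_fun setT (fun x => l0 x - l1 x) by exact: measurable_funB.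
have val0 : (\int[P1]_x (g0 x * ln (g0 x))%:E = (\int[P]_x (l0 x - l1 x))%:E)%E.
  have := @Rintegral_weighted_pushforward _ _ _ _ _ P1 P id g0 (@measurable_id _ T setT)
     mg0 g00 Pg0 _ il.
  have /(integrable_weighted_pushforward (@measurable_id _ T setT) mg0 g00 Pg0 md) := il.
  move=> i1 ->; rewrite EFin_Rintegral//; apply: eq_integral => x _.
  by rewrite /g0 expRK mulrC.
have ig0 : P1.-integrable setT (EFin \o g0).
  by apply: rintegrable_ge0 => //; rewrite -Pg0// probability_setT ltry.
rewrite /KL -[RHS]ereal_inf1; congr ereal_inf; apply/seteqP; split.
- move=> _ [g [mg [gp gA]] <-] /=; rewrite -val0.
  have gg0 : ae_eq P1 setT (EFin \o g0) (EFin \o g).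
    apply: integral_ae_eq => //; first exact/measurable_EFinP.
    by move=> C _ mC; rewrite -Pg0// gA.
  apply: ae_eq_integral => //.
  + by apply/measurable_EFinP; exact: measurable_fun_xlnx.
  + by apply/measurable_EFinP; exact: measurable_fun_xlnx.
  + by apply: filterS gg0 => x /(_ Logic.I)[->] _.
- by move=> _ ->; exists g0 => //; split => //; split.
Qed.

End log_densities.

(** Let [g = exp (l1 - l0)], of mean one. The integral of [g - ln g - 1] is nonpositive, yet the
    tangent inequality at [a = 1], [s = g] bounds the integrand below by [(sqrt g - 1)^2]; hence
    [g = 1] almost everywhere. *)
Lemma gibbs_equality d (T : measurableType d) (R : realType)
    (mu : {measure set T -> \bar R}) (P P1 : probability T R) (l0 l1 : T -> R) :
  measurable_fun setT l0 -> measurable_fun setT l1 ->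
  (forall A, measurable A -> P A = (\int[mu]_(x in A) (expR (l0 x))%:E)%E) ->
  (forall A, measurable A -> P1 A = (\int[mu]_(x in A) (expR (l1 x))%:E)%E) ->
  P.-integrable setT (EFin \o (fun x => l1 x - l0 x)) ->
  0 <= \int[P]_x (l1 x - l0 x) -> forall A, measurable A -> P1 A = P A.
Proof.
move=> ml0 ml1 PE P1E il le0.
pose g x := expR (l1 x - l0 x).
have md : measurable_fun setT (fun x => l1 x - l0 x) by exact: measurable_funB.
have mg : measurable_fun setT g by exact: measurableT_comp.
have g0 x : 0 <= g x by exact: expR_ge0.
have P1g := density_exp_sub ml1 ml0 P1E PE.
have g1 : (\int[P]_x (g x)%:E = 1)%E by rewrite -P1g// probability_setT.
have ig : P.-integrable setT (EFin \o g) by apply: rintegrable_ge0 => //; rewrite g1 ltry.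
have ae1 : {ae P, forall x, g x = 1}.
  apply: (@sqrt_sub1_integral_le0_ae _ _ _ P g (fun x => g x - (l1 x - l0 x) - 1)) => //.
  - by apply: rintegrableB; [exact: rintegrableB|exact: rintegrable_cst].
  - move=> x; have := @xlnx_tangent_hellinger R 1 (g x) ler01 (expR_gt0 _).
    rewrite sqrtr1 /xlnx ln1 mulr0 mul1r expRK -sqrrN opprB; lra.
  - rewrite RintegralB//; [|exact: rintegrableB|exact: rintegrable_cst].
    rewrite RintegralB// Rintegral_probability_cst /Rintegral g1 /=.
    by move: le0; rewrite /Rintegral; lra.
move=> A mA; rewrite P1g//.
rewrite (@ae_eq_integral _ _ _ P A (cst 1%E))//.
- by rewrite integral_cst// mul1e.
- by apply: measurable_funTS; exact/measurable_EFinP.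
- by apply: filterS ae1 => x gx _; rewrite -[expR _]/(g x) gx.
Qed.

(** * Approximate maximisers and extended real levels *)

Lemma ereal_sup_near_optimal (R : realType) (Th : Type) (A B : set Th) (S : Th -> R)
    (M b eta : R) : A `<=` B -> B !=set0 -> 0 < eta ->
  (forall th th', B th -> B th' -> S th <= S th' + M) ->
  (ereal_sup [set (S th)%:E | th in B] <= ereal_sup [set (S th)%:E | th in A] + b%:E)%E ->
  exists2 th, A th & forall th', B th' -> S th' <= S th + b + eta.
Proof.
move=> AB [th1 Bth1] eta0 bd h.
have supB_ge th : B th -> ((S th)%:E <= ereal_sup [set (S th)%:E | th in B])%E.
  by move=> Bth; apply: ereal_sup_ubound; exists th.
have [[th0 Ath0]|A0] := pselect (A !=set0); last first.
  have := le_trans (supB_ge _ Bth1) h.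
  rewrite (_ : [set (S th)%:E | th in A] = set0) ?ereal_sup0//.
  by apply/seteqP; split => // t [th Ath _]; case: A0; exists th.
have fA : ereal_sup [set (S th)%:E | th in A] \is a fin_num.
  rewrite fin_numE; apply/andP; split; apply/eqP => hy.
    have : ((S th0)%:E <= ereal_sup [set (S th)%:E | th in A])%E.
      by apply: ereal_sup_ubound; exists th0.
    by rewrite hy.
  have : (ereal_sup [set (S th)%:E | th in A] <= (S th0 + M)%:E)%E.
    by apply: ge_ereal_sup => _ [th Ath <-]; rewrite lee_fin bd//; exact: AB.
  by rewrite hy.
have [_ [th Ath <-] hth] := ub_ereal_sup_adherent eta0 fA.
exists th => // th' /supB_ge h'; have := le_trans h' h.
move: hth; rewrite -(fineK fA) -EFinB -EFinD lte_fin lee_fin; lra.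
Qed.

Lemma lte_oppe_real_between (R : realType) (x y : \bar R) : (- x < y)%E ->
  exists r : R, (r%:E < x)%E /\ ((- r)%:E < y)%E.
Proof.
case: x => [x| |]; case: y => [y| |] //=; rewrite ?lte_fin => h.
- by exists ((x - y) / 2); rewrite !lte_fin; split; lra.
- by exists (x - 1); rewrite lte_fin ltry; split => //; lra.
- by exists (1 - y); rewrite lte_fin ltry; split => //; lra.
- by exists 0; rewrite !ltry.
Qed.

(** For [m <= 1] there is no index and the infimum is [+oo], which covers the order [1]. *)
Lemma ereal_inf_finite_gt0 (R : realType) (f : nat -> \bar R) (m : nat) :
  (forall k, (1 <= k < m)%N -> (0 < f k)%E) ->
  (0 < ereal_inf [set f k | k in [set k | (1 <= k < m)%N]])%E.
Proof.
elim: m => [|m IH] f0.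
  rewrite (_ : [set f k | k in _] = set0) ?ereal_inf0//.
  by apply/seteqP; split => // x [k /=]; rewrite ltn0 andbF.
have IH' : (0 < ereal_inf [set f k | k in [set k | (1 <= k < m)%N]])%E.
  by apply: IH => k /andP[k1 km]; apply: f0; rewrite k1 ltnW.
have [->|m0] := eqVneq m 0%N.
  rewrite (_ : [set f k | k in _] = set0) ?ereal_inf0//.
  by apply/seteqP; split => // x [k /=]; lia.
have fm : (0 < f m)%E by apply: f0; lia.
apply: (@lt_le_trans _ _ (mine (ereal_inf [set f k | k in [set k | (1 <= k < m)%N]]) (f m))).
  by rewrite lt_min IH' fm.
apply: le_ereal_inf_tmp => x [k /= /andP[k1]]; rewrite ltnS leq_eqVlt.
move=> /orP[/eqP -> <-|km <-]; rewrite ge_min ?lexx ?orbT//.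
by apply/orP; left; apply: ereal_inf_lbound; exists k => //=; rewrite k1.
Qed.

(** * Rate bound and positivity for one nested pair *)

Section entropy_rates.
Context d (T : measurableType d) (R : realType) (P : probability T R).
Variables (Th : pseudoMetricType R) (A B : set Th) (l : Th -> T -> R) (e : T -> R).
Hypothesis cA : compact A.
Hypothesis cB : compact B.
Hypothesis AB : A `<=` B.
Hypothesis Ll : forall th, B th -> Ltau P (l th).
Hypothesis cl : forall z, {within B, continuous (fun th => l th z)}.
Hypothesis me : all_exp_moments P e.
Hypothesis le : forall th th' z, B th -> B th' -> `|l th z - l th' z| <= e z.

(** [S] is abstract so that [Lambda] and [Gamma] share the argument: entropies tending to [0] inside
    [S] produce a parameter that is optimal in mean under [P] itself. *)
Lemma KLset_le0_optimal (S : set (probability T R)) :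
  (forall Q, S Q -> (- 0%:E <= supQ l A (integral_functional Q)
                             - supQ l B (integral_functional Q))%E) ->
  (KLset S P <= 0)%E ->
  exists2 th, A th & forall th', B th' -> 0 <= \int[P]_x (l th x - l th' x).
Proof.
move=> hS KL0; have ml th : B th -> measurable_fun setT (l th) by move=> /Ll[].
have [|th [q [Ath opt]]] := near_optimal_closure (r := 0) cA cB AB ml cl me le.
  move=> eps eps0; have /ereal_inf_lt[_ [Q SQ <-] KLQ] : (KLset S P < eps%:E)%E.
    by apply: le_lt_trans KL0 _; rewrite lte_fin.
  exact: (probs_in_near_optimal AB Ll me le eps0 KLQ (hS _ SQ)).
exists th => //; exact: (near_optimal_zero_entropy Ll (AB Ath) opt).
Qed.

Context dO (Omega : measurableType dO) (Prob : probability Omega R).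
Variable Zs : nat -> Omega -> T.
Hypothesis Zs_meas : forall i, measurable_fun setT (Zs i).
Hypothesis Zs_law : forall i A, measurable A -> Prob (Zs i @^-1` A) = P A.
Hypothesis Zs_indep : forall (n : nat) (A : nat -> set T),
  (forall i, measurable (A i)) ->
  Prob (\bigcap_(i in `I_n) (Zs i @^-1` A i)) =
    (\prod_(i < n) Prob (Zs i @^-1` A i))%E.
Variables (E : nat -> set Omega) (pen : nat -> R).
Hypothesis mE : forall n, measurable (E n).
Hypothesis pen0 : pen n / n%:R @[n --> \oo] --> 0.
Hypothesis E_near_sup : forall n w (eta : R), E n w -> 0 < eta ->
  exists2 th, A th & forall th', B th' ->
    \sum_(i < n) l th' (Zs i w) <= \sum_(i < n) l th (Zs i w) + pen n + eta.
Hypothesis msup : forall n, measurable_fun setT (fun w : Omega =>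
  ereal_sup [set (\sum_(i < n) l th (Zs i w))%:E | th in B]).

Lemma exp_likely_probs_in r' r : r' < r -> exp_likely Prob E r' ->
  exists Q : probability T R, [/\ (KL Q P <= r%:E)%E, prob_in_dual P Q,
    Qset P (integral_functional Q) &
    (- 0%:E <= supQ l A (integral_functional Q) - supQ l B (integral_functional Q))%E].
Proof.
move=> rr' hE; have ml th : B th -> measurable_fun setT (l th) by move=> /Ll[].
have [|n X mX|th [q [Ath opt]]] := @exp_likely_near_optimal _ _ _ P _ A B l e cA cB AB ml cl
    me le _ _ Prob Zs Zs_meas Zs_law Zs_indep E (fun n => pen n / n%:R) mE pen0 _ _ r' r rr' hE.
- move=> n w eta n0 Ew eta0; have [th Ath opt] := E_near_sup Ew eta0.
  by exists th => //; rewrite mulrC divfK// pnatr_eq0 -lt0n.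
- rewrite (_ : mkset _ = setT `&` [set w |
    (ereal_sup [set (\sum_(i < n) l th (Zs i w))%:E | th in B] <= (X w)%:E)%E]).
    by apply: measurable_lee => //; exact/measurable_EFinP.
  rewrite setTI; apply/seteqP; split => w /= h.
    by apply: ge_ereal_sup => _ [th Bth <-]; rewrite lee_fin h.
  move=> th Bth; rewrite -lee_fin; apply: le_trans h.
  by apply: ereal_sup_ubound; exists th.
- exact: (near_optimal_probs_in AB Ll Ath opt).
Qed.

End entropy_rates.

(** * Underestimation of the order by the local and the global estimator *)

Unset Implicit Arguments.
Set Strict Implicit.

Theorem theorem8
  (R : realType)
  (* Z Polish (complete metric, separable), with its Borel sigma-field *)
  (Z : completePseudoMetricType R)
  (Z_hausdorff : hausdorff_space Z) (Z_separable : separable_space Z)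
  (* mu sigma-finite; P* << mu with density p* = exp l* *)
  (mu : {measure set (borelType Z) -> \bar R})
  (mu_sfin : sigma_finite setT mu)
  (Pstar : probability (borelType Z) R)
  (lstar : borelType Z -> R)
  (lstar_meas : measurable_fun setT lstar)
  (Pstar_dens : forall A, measurable A ->
     Pstar A = (\int[mu]_(x in A) (expR (lstar x))%:E)%E)
  (* Z_1, Z_2, ... i.i.d. with law P* *)
  (dO : measure_display) (Omega : measurableType dO)
  (Prob : probability Omega R)
  (Zs : nat -> Omega -> borelType Z)
  (Zs_meas : forall i, measurable_fun setT (Zs i))
  (Zs_law : forall i A, measurable A -> Prob (Zs i @^-1` A) = Pstar A)
  (Zs_indep : forall (n : nat) (A : nat -> set (borelType Z)),
     (forall i, measurable (A i)) ->
     Prob (\bigcap_(i in `I_n) (Zs i @^-1` A i)) =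
       (\prod_(i < n) Prob (Zs i @^-1` A i))%E)
  (* nested parameter spaces, models P_theta with densities exp l_theta *)
  (Th : pseudoMetricType R) (Theta : nat -> set Th)
  (Theta0 : Theta 0%N = set0)
  (Theta_nested : forall K, (1 <= K)%N -> Theta K `<=` Theta K.+1)
  (l : Th -> borelType Z -> R) (Pth : Th -> probability (borelType Z) R)
  (l_meas : forall th, Theta_inf Theta th -> measurable_fun setT (l th))
  (Pth_dens : forall th, Theta_inf Theta th -> forall A, measurable A ->
     Pth th A = (\int[mu]_(x in A) (expR (l th x))%:E)%E)
  (* the order K* *)
  (Kstar : nat)
  (Kstar_order : inPi Theta Pth Kstar Pstar /\
                 ~ inPi Theta Pth Kstar.-1 Pstar)
  (* (A1) *)
  (A1_Theta : forall K, (1 <= K)%N -> compact (Theta K))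
  (A1_Pi : forall K, (1 <= K)%N -> weakly_compact (Pth @` Theta K))
  (* (A2) *)
  (A2 : forall K (z : borelType Z), (1 <= K)%N ->
     {within Theta K, continuous (fun th => l th z)})
  (* (A3) *)
  (lo up : borelType Z -> R)
  (A3_int : Pstar.-integrable setT (fun z => (up z - lo z)%:E))
  (A3_star : forall z, lo z <= lstar z <= up z)
  (A3_models : forall th z, Theta_inf Theta th -> lo z <= l th z <= up z)
  (* (A4) *)
  (pen : nat -> nat -> R)
  (pen_pos : forall n K, 0 < pen n K)
  (pen_incr : forall n K K', (K <= K')%N -> pen n K <= pen n K')
  (pen_infty : forall K, (fun n => pen n K) @ \oo --> +oo)
  (pen_small : forall K, (fun n => pen n K / n%:R) @ \oo --> 0)
  (* finite entropies, p_theta l_theta in L^1(mu) *)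
  (KL_models_fin : forall th, Theta_inf Theta th ->
     (KL (Pth th) Pstar < +oo)%E)
  (pl_int : forall th, Theta_inf Theta th ->
     mu.-integrable setT (fun z => (expR (l th z) * l th z)%:E))
  (* (i) *)
  (hyp_i : forall th, Theta_inf Theta th -> Ltau Pstar (l th))
  (* (ii) *)
  (hyp_ii : forall K, (1 <= K)%N -> forall phi, Qset Pstar phi ->
     exists eps0 : R, 0 < eps0 /\ forall eps : R, 0 < eps < eps0 ->
       exists T : seq Th, (forall t, t \in T -> Theta K t) /\
         forall th, Theta K th ->
           exists t, t \in T /\ `|phi (l th) - phi (l t)| <= eps)
  (* each Theta_K sits in a finite-dimensional normed space whose norm
     induces d *)
  (m : nat -> nat) (chart : forall K, Th -> 'rV[R]_(m K))
  (N : forall K, 'rV[R]_(m K) -> R)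
  (N_norm : forall K, is_norm (N K))
  (chart_inj : forall K th th', (1 <= K)%N -> Theta K th -> Theta K th' ->
     chart K th = chart K th' -> th = th')
  (chart_metric : forall K th th' (r : R), (1 <= K)%N ->
     Theta K th -> Theta K th' -> 0 < r ->
     (ball th r th' <-> N K (chart K th' - chart K th) < r))
  (* (iii) *)
  (hyp_iii : Mtau Pstar (fun z => up z - lo z))
  (* (iv) *)
  (hyp_iv : forall K, (1 <= K <= Kstar)%N ->
     exists (ldot : Th -> borelType Z -> 'rV[R]_(m K))
            (F : borelType Z -> R),
       Ltau Pstar F /\
       forall th, Theta K th ->
         N_interior (N K) (chart K @` Theta K) (chart K th) ->
         (forall i, Mtau Pstar (fun z => ldot th z ord0 i)) /\
         exists o : 'rV[R]_(m K) -> R,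
           (forall eps : R, 0 < eps -> exists delta : R, 0 < delta /\
              forall h, N K h < delta -> `|o h| <= eps * N K h) /\
           exists delta : R, 0 < delta /\
             forall th', Theta K th' ->
               N K (chart K th' - chart K th) < delta ->
               forall z,
                 `|l th' z - l th z
                   - dotv (ldot th z) (chart K th' - chart K th)|
                 <= F z * o (chart K th' - chart K th))
  (* all suprema are measurable *)
  (crit_meas : forall n K,
     measurable_fun [set: Omega] (crit Theta l pen Zs n K : Omega -> \bar R)) :
  (* (a) *)
  ((forall K, (1 <= K)%N -> ~ inPi Theta Pth K Pstar ->
      (KL_to_model Theta Pth Pstar K.+1 < KL_to_model Theta Pth Pstar K)%E) ->
   (limn_esup (log_rate Prob (event_L Theta l pen Zs Kstar))
      <= - ereal_inf [set KLset (probs_in Pstar (Lambda Pstar Theta l 0 K)) Pstar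
                       | K in [set K | (1 <= K < Kstar)%N]])%E /\
   (- ereal_inf [set KLset (probs_in Pstar (Lambda Pstar Theta l 0 K)) Pstar
                       | K in [set K | (1 <= K < Kstar)%N]] < 0)%E)
  /\
  (* (b) *)
  ((limn_esup (log_rate Prob (event_G Theta l pen Zs Kstar))
      <= - KLset (probs_in Pstar (Gamma Pstar Theta l Kstar 0 Kstar.-1)) Pstar)%E /\
   (- KLset (probs_in Pstar (Gamma Pstar Theta l Kstar 0 Kstar.-1)) Pstar < 0)%E).
Proof.
(* This envelope gives all exponential moments to the differences [l th - l th'], whereas each
   [l th] is only assumed to lie in [L_tau]. *)
pose e z := up z - lo z.
have me : all_exp_moments Pstar e by exact: Mtau_all_exp_moments.
have inf K th : (1 <= K)%N -> Theta K th -> Theta_inf Theta th by exists K.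
have le th th' z : Theta_inf Theta th -> Theta_inf Theta th' -> `|l th z - l th' z| <= e z.
  move=> /(A3_models th z)/andP[h1 h2] /(A3_models th' z)/andP[h3 h4].
  by rewrite /e ler_norml; apply/andP; split; lra.
have mono K K' : (1 <= K)%N -> (K <= K')%N -> Theta K `<=` Theta K'.
  move=> K1; elim: K' => [|K' IH]; first by case: K K1.
  rewrite leq_eqVlt => /orP[/eqP -> //|]; rewrite ltnS => KK'.
  by apply: subset_trans (IH KK') _; apply: Theta_nested; exact: leq_trans KK'.
case: Kstar_order => -[Ks1 [ths [Tths Pths]]] nPi.
have ie th th' : Theta_inf Theta th -> Theta_inf Theta th' ->
    Pstar.-integrable setT (EFin \o (fun z => l th z - l th' z)).
  move=> h h'; apply: rintegrable_dominated A3_int _ => [|z]; last exact: le.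
  by apply: measurable_funB; exact: l_meas.
have sinf : Theta_inf Theta ths by exact: inf Tths.
(* From here [l ths] serves as log-density of [Pstar], so that every comparison is between members
   of the model. *)
have Psd A : measurable A -> Pstar A = (\int[mu]_(x in A) (expR (l ths x))%:E)%E.
  by move=> mA; rewrite -Pths// Pth_dens.
have KLE th : Theta_inf Theta th -> KL Pstar (Pth th) = (\int[Pstar]_x (l ths x - l th x))%:E.
  move=> h; apply: (KL_log_densities (l_meas _ sinf) (l_meas _ h) Psd (Pth_dens _ h)).
  exact: ie.
(* Adding the deterministic penalty back to [crit] recovers the supremum. *)
have msup n K : measurable_fun setT (fun w : Omega =>
    ereal_sup [set (\sum_(i < n) l th (Zs i w))%:E | th in Theta K]).
  rewrite (_ : (fun w => _) = (fun w => crit Theta l pen Zs n K w + (pen n K)%:E)%E).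
    by apply: emeasurable_funD.
  by apply/funext => w; rewrite /crit subeK.
(* Losing against a larger model means that its likelihood gain is at most
   its penalty. *)
have near_sup n K K' w (eta : R) : (1 <= K)%N -> (K <= K')%N -> Theta K' !=set0 ->
    (crit Theta l pen Zs n K' w <= crit Theta l pen Zs n K w)%E -> 0 < eta ->
    exists2 th, Theta K th & forall th', Theta K' th' ->
      \sum_(i < n) l th' (Zs i w) <= \sum_(i < n) l th (Zs i w) + pen n K' + eta.
  move=> K1 KK' ne h eta0.
  apply: (@ereal_sup_near_optimal _ _ _ _ (fun th => \sum_(i < n) l th (Zs i w))
    (\sum_(i < n) e (Zs i w))) => //; first exact: mono.
    move=> th th' Bth Bth'; rewrite -big_split /=; apply: ler_sum => i _.
    have K'1 := leq_trans K1 KK'.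
    have := le _ _ (Zs i w) (inf _ _ K'1 Bth) (inf _ _ K'1 Bth').
    by rewrite ler_norml => /andP[_]; lra.
  rewrite -leeBlDr//; apply: le_trans h _.
  by rewrite /crit leeBlDr// leeDl// lee_fin ltW.
have mcrit n K K' : measurable [set w | (crit Theta l pen Zs n K w <= crit Theta l pen Zs n K' w)%E].
  rewrite -[mkset _]setTI; exact: measurable_lee.
have mcritlt n K K' : measurable [set w | (crit Theta l pen Zs n K w < crit Theta l pen Zs n K' w)%E].
  rewrite -[mkset _]setTI; exact: measurable_lte.

have notPi K : (1 <= K < Kstar)%N -> ~ inPi Theta Pth K Pstar.
  move=> /andP[K1 KKs] [_ [th [Tth Pthth]]]; apply: nPi; split; first by lia.
  by exists th; split => //; apply: (mono K) Tth => //; lia.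
split.
- move=> strict.
  (* The strict inequality makes the left infimum smaller than [+oo], the infimum of the empty
     set. *)
  have ne K : (1 <= K < Kstar)%N -> Theta K.+1 !=set0.
    move=> hK; have /andP[K1 _] := hK; have := strict K K1 (notPi K hK).
    move=> /lt_le_trans-/(_ _ (leey _))/ereal_inf_lt[_ [th Tth _] _].
    by exists th.
  pose E K n := [set w | (crit Theta l pen Zs n K.+1 w <= crit Theta l pen Zs n K w)%E].
  have pairs K : (1 <= K < Kstar)%N -> [/\ compact (Theta K), compact (Theta K.+1),
      Theta K `<=` Theta K.+1, (forall th, Theta K.+1 th -> Ltau Pstar (l th)) &
      (forall z, {within Theta K.+1, continuous (fun th => l th z)}) /\
      (forall th th' z, Theta K.+1 th -> Theta K.+1 th' -> `|l th z - l th' z| <= e z)].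
    move=> /andP[K1 KKs]; split; [exact: A1_Theta|exact: A1_Theta|exact: Theta_nested| |].
      by move=> th Tth; apply: hyp_i; exact: inf Tth.
    split; first by move=> z; exact: A2.
    by move=> th th' z Tth Tth'; apply: le; exact: (inf K.+1).
  split.
  + rewrite leNgt; apply/negP => /lte_oppe_real_between[r [r_inf r_sup]].
    have mE n : measurable (event_L Theta l pen Zs Kstar n).
      rewrite (_ : event_L _ _ _ _ _ _ = \bigcup_(K in [set K | (1 <= K < Kstar)%N]) E K n).
        by apply: bigcup_measurable => K _; exact: mcrit.
      apply/seteqP; split => w.
        by move=> [K [hK h]]; exists K.
      by move=> [K hK h]; exists K.
    have [r1 r1r hr1] := limn_esup_exp_likely mE r_sup.
    (* The gap below [r] is spent twice: half on choosing one [K] among finitely many, half on the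
       net within that model. *)
    have r12 : r1 < (r1 + r) / 2 by lra.
    have EE n w : event_L Theta l pen Zs Kstar n w -> exists2 K, K \in iota 1 Kstar.-1 & E K n w.
      by move=> [K [hK h]]; exists K => //; rewrite mem_iota; lia.
    have [K Ks hK] := exp_likely_finite_union mE (fun K n _ => mcrit n K.+1 K) EE r12 hr1.
    have {}Ks : (1 <= K < Kstar)%N by move: Ks; rewrite mem_iota; lia.
    have [cA cB AB Ll [cl leB]] := pairs K Ks.
    have r2r : (r1 + r) / 2 < r by lra.
    have ns n w (eta : R) : E K n w -> 0 < eta ->
        exists2 th, Theta K th & forall th', Theta K.+1 th' ->
          \sum_(i < n) l th' (Zs i w) <= \sum_(i < n) l th (Zs i w) + pen n K.+1 + eta.
      by move=> Ew; apply: near_sup => //; [lia|exact: ne].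
    have [Q [KLQ dQ qQ supQ]] := exp_likely_probs_in cA cB AB Ll cl me leB Zs_meas Zs_law
      Zs_indep (fun n => mcrit n K.+1 K) (pen_small K.+1) ns (msup^~ K.+1) r2r hK.
    move: r_inf; rewrite ltNge => /negP; apply; apply: le_trans KLQ.
    apply: (@le_trans _ _ (KLset (probs_in Pstar (Lambda Pstar Theta l 0 K)) Pstar)).
      by apply: ereal_inf_lbound; exists K.
    by apply: ereal_inf_lbound; exists Q.
  + rewrite oppe_lt0; apply: ereal_inf_finite_gt0 => K hK.
    have /andP[K1 KKs] := hK.
    have [cA cB AB Ll [cl leB]] := pairs K hK.
    rewrite ltNge; apply/negP => le0.
    have [|th Tth opt] := @KLset_le0_optimal _ _ _ Pstar _ _ _ l e cA cB AB Ll cl me leB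
      (probs_in Pstar (Lambda Pstar Theta l 0 K)) _ le0.
      by move=> Q [_ [_]].
    (* Optimality in mean under [Pstar] says that [th] is at least as close to [Pstar] in entropy as
       every element of the larger model, against strict decrease. *)
    have := strict K K1 (notPi K hK); rewrite ltNge => /negP; apply.
    apply: le_ereal_inf_tmp => _ [th' Tth' <-].
    apply: (@le_trans _ _ (KL Pstar (Pth th))).
      by apply: ereal_inf_lbound; exists th.
    have hth := inf _ _ K1 Tth; have hth' := inf K.+1 th' isT Tth'.
    rewrite !KLE// lee_fin -subr_ge0 -RintegralB//; [|exact: ie|exact: ie].
    rewrite (_ : (fun x => _) = (fun x => l th x - l th' x)); first exact: opt.
    by apply/funext => x; ring.
(* When [Kstar = 1] the smaller model is [Theta 0], which is empty. *)
- have cA : compact (Theta Kstar.-1).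
    case: (Kstar) => [|[|K]] /=; [|rewrite Theta0; exact: compact0..|exact: A1_Theta].
    by rewrite Theta0; exact: compact0.
  have cB := A1_Theta _ Ks1.
  have AB : Theta Kstar.-1 `<=` Theta Kstar.
    case: (posnP Kstar.-1) => [->|h]; first by rewrite Theta0.
    by apply: mono => //; lia.
  have Ll th : Theta Kstar th -> Ltau Pstar (l th).
    by move=> Tth; apply: hyp_i; exact: inf Tth.
  have cl z : {within Theta Kstar, continuous (fun th => l th z)} by exact: A2.
  have leB th th' z : Theta Kstar th -> Theta Kstar th' -> `|l th z - l th' z| <= e z.
    by move=> Tth Tth'; apply: le; exact: (inf Kstar).
  split.
  + rewrite leNgt; apply/negP => /lte_oppe_real_between[r [r_inf r_sup]].
    have mE n : measurable (event_G Theta l pen Zs Kstar n).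
      rewrite (_ : event_G _ _ _ _ _ _ = \bigcup_(K in [set K | (1 <= K < Kstar)%N])
        ((\bigcap_(K' in [set K' | (1 <= K')%N])
           [set w | (crit Theta l pen Zs n K' w <= crit Theta l pen Zs n K w)%E]) `&`
         (\bigcap_(K' in [set K' | (1 <= K' < K)%N])
           [set w | (crit Theta l pen Zs n K' w < crit Theta l pen Zs n K w)%E]))).
        apply: bigcup_measurable => K _; apply: measurableI.
          by apply: bigcap_measurableType => K' _; exact: mcrit.
        by apply: bigcap_measurableType => K' _; exact: mcritlt.
      apply/seteqP; split => w.
        by move=> [K [hK [h1 h2]]]; exists K.
      by move=> [K hK [h1 h2]]; exists K.
    have [r1 r1r hr1] := limn_esup_exp_likely mE r_sup.
    have ns n w (eta : R) : event_G Theta l pen Zs Kstar n w -> 0 < eta ->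
        exists2 th, Theta Kstar.-1 th & forall th', Theta Kstar th' ->
          \sum_(i < n) l th' (Zs i w) <= \sum_(i < n) l th (Zs i w) + pen n Kstar + eta.
      (* The maximiser [K] is compared with [Kstar] alone, and its parameter also belongs to the
         model of order [Kstar.-1], so a single pair of models is enough. *)
      move=> [K [/andP[K1 KKs] [hmax _]]] eta0.
      have [th Tth opt] := near_sup n K Kstar w eta K1 (ltnW KKs)
        (ex_intro _ ths Tths) (hmax _ Ks1) eta0.
      by exists th => //; apply: (mono K) Tth => //; lia.
    have [Q [KLQ dQ qQ supQ]] := exp_likely_probs_in cA cB AB Ll cl me leB Zs_meas Zs_law
      Zs_indep mE (pen_small Kstar) ns (msup^~ Kstar) r1r hr1.
    move: r_inf; rewrite ltNge => /negP; apply; apply: le_trans KLQ.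
    by apply: ereal_inf_lbound; exists Q.
  + rewrite oppe_lt0 ltNge; apply/negP => le0.
    have [|th Tth opt] := @KLset_le0_optimal _ _ _ Pstar _ _ _ l e cA cB AB Ll cl me leB
      (probs_in Pstar (Gamma Pstar Theta l Kstar 0 Kstar.-1)) _ le0.
      by move=> Q [_ [_]].
    have Ks2 : (1 <= Kstar.-1)%N.
      by case: (posnP Kstar.-1) => // h; move: Tth; rewrite h Theta0.
    (* Optimality against [ths] is the equality case of Gibbs' inequality, so [Pth th] would be
       [Pstar] in a model below the order. *)
    apply: nPi; split => //; exists th; split => //.
    have hth := inf _ _ Ks2 Tth.
    apply: (gibbs_equality (l_meas _ sinf) (l_meas _ hth) Psd (Pth_dens _ hth)).
      exact: ie.
    exact: opt.
Qed.
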